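(* For each $n$, let $p=p_n$ and let $\mathbf X_1,\ldots,\mathbf X_n$ be i.i.d. $N(\mathbf 0,\boldsymbol\Sigma)$ in $\mathbb R^p$, where $\boldsymbol\Sigma=\boldsymbol\Sigma_p$ has $\Sigma_{ii}=1$ for all $i$. Assume (i) $p/n\to y\in(0,\infty)$ and (ii) $\mathrm{tr}(\boldsymbol\Sigma^2)=o(p^2)$ as $n\to\infty$. Then $$L\big(F^{\tilde{\boldsymbol\rho}_n},F^{\mathbf W_n}\big)\to 0\quad\text{in probability},$$ where $\tilde{\boldsymbol\rho}_n=\frac{3}{n(n-1)(n-2)}\sum^*_{i,j,k}\mathbf A_{ij}\mathbf A_{ik}^\top$ and $\mathbf W_n=\frac3n\sum_{i=1}^n\mathbf A_i\mathbf A_i^\top$.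
   Context: $\mathbf X_i=(x_{i1},\ldots,x_{ip})^\top$. Sign vectors $\mathbf A_{ik}=\mathrm{sign}(\mathbf X_i-\mathbf X_k)$ (coordinatewise sign). $\mathbf A_i=\mathbb E\{\mathbf A_{ik}\mid\mathbf X_i\}$ for $k\ne i$; in the Gaussian setting with unit diagonal, $\mathbf A_i=(2\Phi(x_{i1})-1,\ldots,2\Phi(x_{ip})-1)^\top$ with $\Phi$ the standard normal cdf. $\sum^*$ denotes summation over mutually distinct indices in $\{1,\ldots,n\}$. For a $p\times p$ Hermitian matrix $\mathbf H$ with eigenvalues $\lambda_1,\ldots,\lambda_p$, its empirical spectral distribution is $F^{\mathbf H}(x)=\frac1p\sum_{i}I(\lambda_i\le x)$. $L(\cdot,\cdot)$ is the Lévy distance between distribution functions. *)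

(* Defs.v *)
From HB Require Import structures.
From mathcomp Require Import all_boot all_order all_algebra.
From mathcomp Require Import all_classical all_reals all_analysis.
Set Implicit Arguments. Unset Strict Implicit. Unset Printing Implicit Defensive.
Import Order.TTheory GRing.Theory Num.Theory.
Local Open Scope classical_set_scope.
Local Open Scope ring_scope.

Section Defs.
Variable R : realType.

Definition gauss_law (v : R) (B : set R) : \bar R :=
  if v == 0 then (\1_B (0:R))%:E else normal_prob 0 (Num.sqrt v) B.

Definition Phi (x : R) : R := fine (normal_prob (0:R) 1 [set t | t <= x]).

Context {d : measure_display} {T : measurableType d}.

(* Mutual independence of the random vectors X_0,...,X_{n-1} in R^p
   (coordinates X i k), stated on the generating pi-system of
   measurable rectangles. *)
Definition indep_vectors (P : probability T R) (n p : nat)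
  (X : 'I_n -> 'I_p -> T -> R) : Prop :=
  forall B : 'I_n -> 'I_p -> set R, (forall i k, measurable (B i k)) ->
  P (\bigcap_(i in [set: 'I_n]) \bigcap_(k in [set: 'I_p]) (X i k @^-1` B i k))
  = (\prod_(i < n) P (\bigcap_(k in [set: 'I_p]) (X i k @^-1` B i k)))%E.

(* Y : T -> R^p is N(0, S) : every linear combination a^T Y is
   N(0, a^T S a) (Cramer-Wold definition of a Gaussian vector). *)
Definition gaussian_vector (P : probability T R) (p : nat)
  (S : 'M[R]_p) (Y : 'I_p -> T -> R) : Prop :=
  forall (a : 'cV[R]_p) (B : set R), measurable B ->
  P ((fun w => \sum_(k < p) a k 0 * Y k w) @^-1` B)
  = gauss_law ((a^T *m S *m a) 0 0) B.

Definition Asign (n p : nat) (X : 'I_n -> 'I_p -> T -> R) (w : T)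
  (i j : 'I_n) : 'cV[R]_p := \col_k Num.sg (X i k w - X j k w).

(* A_i = E(A_ik | X_i) = (2 Phi(x_i1) - 1, ..., 2 Phi(x_ip) - 1) *)
Definition Acond (n p : nat) (X : 'I_n -> 'I_p -> T -> R) (w : T)
  (i : 'I_n) : 'cV[R]_p := \col_k (2 * Phi (X i k w) - 1).

Definition rho_tilde (n p : nat) (X : 'I_n -> 'I_p -> T -> R) (w : T)
  : 'M[R]_p :=
  (3 / (n%:R * (n%:R - 1) * (n%:R - 2))) *:
  \sum_(i < n) \sum_(j < n) \sum_(k < n | (i != j) && (i != k) && (j != k))
     (Asign X w i j *m (Asign X w i k)^T).

Definition Wmat (n p : nat) (X : 'I_n -> 'I_p -> T -> R) (w : T)
  : 'M[R]_p :=
  (3 / n%:R) *: \sum_(i < n) (Acond X w i *m (Acond X w i)^T).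
End Defs.

Section Spectral.
Variable R : realType.

(* the eigenvalues (with multiplicity) of H, when its characteristic
   polynomial splits over R (always the case for real symmetric H);
   they are unique up to permutation. *)
Definition eigseq (p : nat) (H : 'M[R]_p) : seq R :=
  match pselect (exists s : seq R, char_poly H = \prod_(r <- s) ('X - r%:P))
  with
  | left e => projT1 (cid e)
  | right _ => [::]
  end.

Definition esd (p : nat) (H : 'M[R]_p) (x : R) : R :=
  (count (fun l => l <= x) (eigseq H))%:R / p%:R.

Definition levy (F G : R -> R) : R :=
  inf [set e : R | 0 < e /\
        forall x, F (x - e) - e <= G x /\ G x <= F (x + e) + e].
End Spectral.

(* Main.v *)
Require Import Defs.
From HB Require Import structures.
From mathcomp Require Import all_boot all_order all_algebra.
From mathcomp Require Import all_classical all_reals all_analysis.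
From mathcomp Require Import complex measurable_realfun.
From mathcomp Require Import ring lra zify.
Import Order.TTheory GRing.Theory Num.Theory numFieldNormedType.Exports.
Local Open Scope classical_set_scope.
Local Open Scope ring_scope.
Set Implicit Arguments. Unset Strict Implicit. Unset Printing Implicit Defensive.

(* If [A] and [B] are symmetric and [e > 0], a subspace on which the quadratic
   forms of [A] and [B] differ by more than [e] has dimension at most
   [||A - B||_F^2 / e^2]; counting dimensions of spectral subspaces gives
   [levy (esd A) (esd B) <= e] as soon as [||A - B||_F^2 <= p e^3].  By Markov's
   inequality it is therefore enough that [E ||rho - W||_F^2 = o(p)].

   Write [sg (x_ik - x_jk) = a_ik + u_ijk] with [a_ik = 2 Phi (x_ik) - 1], so that
   [u_ijk] has mean zero given [X_i].  Each entry of [rho - W] is a combination of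
   [u_ijk a_il], [a_ik u_iml] and [u_ijk u_iml], most of which are orthogonal.
   What remains is [O(1 / n^2)], plus [1 / n] times the correlation of
   [u_ijk a_il] and [u_hjk a_hl], two terms sharing only the index [j].  This is
   small with [Sigma_kl]: regress [x_il] on [x_ik] and use that the residual is
   symmetric given [x_ik].  The trace hypothesis makes [Sigma_kl] small on
   average. *)

(** * Spectral perturbation and the Levy distance *)

(** There are [p^2] entries and [p] is of order [n]: the second moments [O(1 / n^2)] add up to
    [O(1)], and the [1 / n] terms to order [p] times an average correlation, so only the
    correlations have to be small. After truncation the correlation bound is linear in [|Sigma_kl|],
    whereas the trace controls squares; it is weakened to [e + C Sigma_kl^2] with [e] as small as
    wished.

    A Gaussian vector is given only by the one-dimensional laws of its linear combinations, without
    joint density or conditional law. The symmetry of a residual [z] given [x] is therefore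
    expressed as [E f(x) h(z) = E f(x) h(-z)]. For cosines it holds because [s x + t z] and
    [s x - t z] have the same variance; bounded limits of trigonometric polynomials carry it to
    signs. Signs suffice, since [2 Phi - 1] is itself the mean of a sign against an independent
    copy. Likewise, conditioning on some of the samples becomes integration over a second,
    independent variable, through a product measure on two sub-sigma-algebras. *)

Lemma char_poly_conj (K : comUnitRingType) n (P A : 'M[K]_n) :
  P \in unitmx -> char_poly (invmx P *m A *m P) = char_poly A.
Proof.
move=> uP; rewrite /char_poly /char_poly_mx.
pose f := fun M : 'M[K]_n => map_mx polyC M.
have PP : f (invmx P) *m f P = 1%:M by rewrite -map_mxM mulVmx // map_mx1.
have -> : 'X%:M - f (invmx P *m A *m P) = f (invmx P) *m ('X%:M - f A) *m f P.
  rewrite mulmxBr mulmxBl -!map_mxM; congr (_ - _).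
  by rewrite mul_mx_scalar -scalemxAl PP scalemx1.
rewrite !det_mulmx mulrAC -det_mulmx PP det1 mul1r //.
Qed.

Lemma mxtrace_sqr_sub (K : comNzRingType) n (D Q : 'M[K]_n) (e : K) : Q *m Q = Q ->
  \tr ((D - e *: Q) *m (D - e *: Q)) = \tr (D *m D) - 2 * e * \tr (D *m Q) + e ^+ 2 * \tr Q.
Proof.
move=> QQ; rewrite mulmxBl !mulmxBr -!scalemxAl -!scalemxAr QQ !raddfB /= !mxtraceZ.
by rewrite [\tr (Q *m D)]mxtrace_mulC; ring.
Qed.

Section SymmetricSpectrum.
Variable R : realType.
Local Open Scope sesquilinear_scope.
Local Notation C := R[i].
Local Notation toC := (real_complex R).

Lemma map_toC_conj m n (A : 'M[R]_(m, n)) : (map_mx toC A)^t* = map_mx toC A^T.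
Proof. by apply/matrixP => i j; rewrite !mxE; exact: conjc_real. Qed.

(** The spectral theorem is applied to [A] as a Hermitian matrix over [R[i]], whose eigenvalues are
    real. Since [eigseq] is a chosen list of roots, determined only up to order, it is linked to [d]
    through counts, by uniqueness of the factorization of [char_poly]. *)
Lemma symmetric_spectral n (A : 'M[R]_n) : A^T = A ->
  exists (P : 'M[C]_n) (d : 'rV[R]_n),
  [/\ P \is unitarymx,
      map_mx toC A = P^t* *m diag_mx (map_mx toC d) *m P &
      forall x, count (fun l => l <= x) (eigseq A) = #|[pred i | d 0 i <= x]|].
Proof.
move=> symA.
have AC : map_mx toC A \is hermsymmx.
  by apply/is_hermitianmxP; rewrite expr0 scale1r map_toC_conj symA.
have /orthomx_spectralP := hermitian_normalmx AC.
set P := spectralmx _; set s := spectral_diag _ => eA.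
have uP : P \is unitarymx by exact: spectral_unitarymx.
pose d : 'rV[R]_n := map_mx (@complex.Re R) s.
have sd : s = map_mx toC d.
  apply/matrixP => i j; rewrite !mxE.
  have /mxOverP /(_ i j) := hermitian_spectral_diag_real AC.
  by rewrite -/s => /complex_realP[x ->].
exists P, d; split => //.
  by rewrite -sd -invmx_unitary.
have cpd : char_poly A = \prod_(i < n) ('X - (d 0 i)%:P).
  apply: (@map_poly_inj _ _ toC).
  rewrite map_char_poly rmorph_prod /= eA sd char_poly_conj ?unitarymx_unit //.
  rewrite char_poly_trig ?diag_mx_is_trig //; apply: eq_bigr => i _.
  by rewrite rmorphB /= map_polyX map_polyC /= !mxE eqxx mulr1n.
have cpe : char_poly A = \prod_(r <- [seq d 0 i | i <- enum 'I_n]) ('X - r%:P).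
  by rewrite big_map big_enum.
move=> x; rewrite /eigseq; case: pselect => [e|[]]; last by exists [seq d 0 i | i <- enum 'I_n].
case: (cid e) => t /=; rewrite cpe => /prod_XsubC_eq /permP <-.
by rewrite count_map -size_filter cardE enumT.
Qed.

Definition frobsq n (A : 'M[R]_n) : R := \sum_i \sum_j A i j ^+ 2.

Lemma rowsub_unitary n (P : 'M[C]_n) (S : {pred 'I_n}) :
  P \is unitarymx -> rowsub (fun k : 'I_#|S| => enum_val k) P \is unitarymx.
Proof.
move=> uP; apply/row_unitarymxP => i j; rewrite !row_rowsub.
by rewrite (row_unitarymxP uP) (inj_eq enum_val_inj).
Qed.

(** The weights are the squared moduli [|W_ij|^2] with [W = V P^*], the coordinates of a unit row of
    [V] in the eigenbasis. They vanish outside [S] because the row is spanned by the eigenvectors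
    that [S] selects; the quadratic form is thus an average of the corresponding eigenvalues. *)
Lemma quad_form_rowsub m n (P : 'M[C]_n) (d : 'rV[R]_n) (V : 'M[C]_(m, n))
    (S : {pred 'I_n}) (i : 'I_m) :
  P \is unitarymx -> V \is unitarymx ->
  (V <= rowsub (fun k : 'I_#|S| => enum_val k) P)%MS ->
  exists w : 'I_n -> R, [/\ forall j, 0 <= w j, forall j, j \notin S -> w j = 0,
    \sum_j w j = 1 &
    (V *m (P^t* *m diag_mx (map_mx toC d) *m P) *m V^t*) i i = toC (\sum_j w j * d 0 j)].
Proof.
move=> uP uV /submxP[U eV].
have [W WE] : exists W, W = V *m P^t* by exists (V *m P^t*).
have W0 j : j \notin S -> W i j = 0.
  move=> jS; rewrite WE eV -mulmxA mul_rowsub_mx (unitarymxP uP) mxE big1 // => k _.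
  rewrite !mxE; case: eqP => [ej|]; last by rewrite mulr0.
  by rewrite -ej enum_valP in jS.
pose w j := complex.Re (W i j) ^+ 2 + complex.Im (W i j) ^+ 2.
have sW j : W i j * (W i j)^* = toC (w j) by rewrite -normCK -add_Re2_Im2.
have WWt : W *m W^t* = 1%:M.
  by rewrite WE trmx_mul map_mxM trmxCK mulmxA mulmxKtV // (unitarymxP uV).
exists w; split.
- by move=> j; rewrite addr_ge0 // sqr_ge0.
- by move=> j jS; rewrite /w W0 //= expr0n /= addr0.
- have /matrixP /(_ i i) := WWt; rewrite !mxE eqxx => e1.
  apply: (@complexI R); rewrite rmorph_sum /= -[RHS]e1.
  by apply: eq_bigr => j _; rewrite !mxE sW.
- have -> : V *m (P^t* *m diag_mx (map_mx toC d) *m P) *m V^t* =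
            W *m diag_mx (map_mx toC d) *m W^t*.
    by rewrite WE trmx_mul map_mxM trmxCK !mulmxA.
  rewrite mul_mx_diag mxE rmorph_sum; apply: eq_bigr => j _.
  by rewrite !mxE rmorphM /= -sW mulrAC.
Qed.

Lemma quad_form_le m n (P : 'M[C]_n) (d : 'rV[R]_n) (V : 'M[C]_(m, n))
    (S : {pred 'I_n}) (x : R) (i : 'I_m) :
  P \is unitarymx -> V \is unitarymx ->
  (V <= rowsub (fun k : 'I_#|S| => enum_val k) P)%MS ->
  (forall j, j \in S -> d 0 j <= x) ->
  (V *m (P^t* *m diag_mx (map_mx toC d) *m P) *m V^t*) i i <= toC x.
Proof.
move=> uP uV VP dx; have [w [w0 wS w1 ->]] := quad_form_rowsub d i uP uV VP.
rewrite lecR -[leRHS]mul1r -w1 mulr_suml; apply: ler_sum => j _.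
have [/dx|/wS ->] := boolP (j \in S); last by rewrite !mul0r.
exact: ler_wpM2l.
Qed.

Lemma quad_form_ge m n (P : 'M[C]_n) (d : 'rV[R]_n) (V : 'M[C]_(m, n))
    (S : {pred 'I_n}) (x : R) (i : 'I_m) :
  P \is unitarymx -> V \is unitarymx ->
  (V <= rowsub (fun k : 'I_#|S| => enum_val k) P)%MS ->
  (forall j, j \in S -> x <= d 0 j) ->
  toC x <= (V *m (P^t* *m diag_mx (map_mx toC d) *m P) *m V^t*) i i.
Proof.
move=> uP uV VP dx; have [w [w0 wS w1 ->]] := quad_form_rowsub d i uP uV VP.
rewrite lecR -[leLHS]mul1r -w1 mulr_suml; apply: ler_sum => j _.
have [/dx|/wS ->] := boolP (j \in S); last by rewrite !mul0r.
exact: ler_wpM2l.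
Qed.

(* Expanding [0 <= \tr ((D - e Pi) (D - e Pi)^* )], where [Pi = V^* V] is the
   projection onto the row space of [V]. *)
Lemma frobsq_ge_trace m n (D : 'M[R]_n) (V : 'M[C]_(m, n)) (e : R) :
  D^T = D -> V \is unitarymx -> 0 <= e ->
  (forall i, toC e <= (V *m map_mx toC D *m V^t*) i i) ->
  m%:R * e ^+ 2 <= frobsq D.
Proof.
move=> symD uV e0 le_e.
pose DC := map_mx toC D; pose Q := V^t* *m V.
have VV := unitarymxP uV.
have DCt : DC^t* = DC by rewrite map_toC_conj symD.
have Qt : Q^t* = Q by rewrite trmx_mul map_mxM trmxCK.
have QQ : Q *m Q = Q by rewrite /Q mulmxA mulmxtVK.
have trQ : \tr Q = m%:R by rewrite mxtrace_mulC VV mxtrace1.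
have trDD : \tr (DC *m DC) = toC (frobsq D).
  rewrite /mxtrace rmorph_sum; apply: eq_bigr => i _.
  rewrite mxE rmorph_sum; apply: eq_bigr => j _.
  by rewrite -{2}DCt !mxE rmorphXn /= expr2; congr (_ * _); exact: conjc_real.
have trDQ : toC (m%:R * e) <= \tr (DC *m Q).
  rewrite /Q mulmxA mxtrace_mulC mulmxA.
  rewrite mulr_natl -[m in leLHS]card_ord -sumr_const rmorph_sum; apply: ler_sum => i _.
  exact: le_e.
pose M := DC - toC e *: Q.
have Mt : M^t* = M.
  rewrite /M linearB /= map_mxB DCt linearZ /= map_mxZ Qt; congr (_ - _ *: _).
  exact: conjc_real.
have : 0 <= \tr (M *m M^t*).
  apply: sumr_ge0 => i _; rewrite mxE; apply: sumr_ge0 => j _.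
  by rewrite !mxE -normCK exprn_ge0.
rewrite Mt /M mxtrace_sqr_sub // trQ trDD.
move: trDQ; move: (\tr (DC *m Q)) => t trDQ h.
have te : toC e * toC (m%:R * e) <= toC e * t by apply: ler_wpM2l; rewrite ?lecR.
rewrite -subr_ge0 -lecR.
have -> : toC (frobsq D - m%:R * e ^+ 2) =
    (toC (frobsq D) - 2 * toC e * t + toC e ^+ 2 * m%:R) +
    2 * (toC e * t - toC e * toC (m%:R * e)).
  rewrite rmorphB !rmorphM rmorph_nat /=; move: (toC (frobsq D)) (toC e) => F E; ring.
by rewrite addr_ge0 // mulr_ge0 // subr_ge0.
Qed.

(** [K] intersects the span of the eigenvectors of [A] with eigenvalue at most [x - e] and the span
    of those of [B] with eigenvalue above [x], so the form of [B - A] is at least [e] on unit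
    vectors of [K]. The count for [A] exceeds that for [B] by at most [\rank K]. *)
Lemma count_eig_le n (A B : 'M[R]_n) (e x : R) :
  A^T = A -> B^T = B -> 0 < e -> frobsq (A - B) <= n%:R * e ^+ 3 ->
  (count (fun l => (l <= x - e)%R) (eigseq A))%:R <=
  (count (fun l => (l <= x)%R) (eigseq B))%:R + n%:R * e.
Proof.
move=> sA sB e0 frobAB.
have [PA [a [uPA eA ->]]] := symmetric_spectral sA.
have [PB [b [uPB eB ->]]] := symmetric_spectral sB.
set SA := [pred i | _]; set SB := [pred i | _].
pose SB' : {pred 'I_n} := [predC SB].
pose UA := rowsub (fun k : 'I_#|SA| => enum_val k) PA.
pose UB := rowsub (fun k : 'I_#|SB'| => enum_val k) PB.
pose K := (UA :&: UB)%MS.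
(* Dimension formula: the two spans have dimensions [#|SA|] and [n - #|SB|], and their sum fits in
   dimension [n]. *)
have rkK : (#|SA| <= \rank K + #|SB|)%N.
  have := mxrank_sum_cap UA UB.
  rewrite [\rank UA]mxrank_unitary ?[\rank UB]mxrank_unitary ?rowsub_unitary // => h.
  have := rank_leq_col (UA + UB)%MS.
  have := cardC SB; rewrite card_ord -/K -/SB' in h *.
  change #|[predC SB]| with #|SB'|.
  by move: h; move: #|SA| #|SB| #|SB'| (\rank K) (\rank _) => *; lia.
pose V := schmidt (row_base K).
have uV : V \is unitarymx by rewrite schmidt_unitarymx // rank_leq_col.
have VK : (V <= K)%MS by rewrite eqmx_schmidt_free ?row_base_free // eq_row_base.
have VA : (V <= UA)%MS by rewrite (submx_trans VK) // capmxSl.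
have VB : (V <= UB)%MS by rewrite (submx_trans VK) // capmxSr.
have := @frobsq_ge_trace _ _ (B - A) V e _ uV (ltW e0) _.
rewrite linearB /= sA sB => /(_ erefl) h.
have {}h : (\rank K)%:R * e ^+ 2 <= frobsq (B - A).
  apply: h => i; rewrite map_mxB mulmxBr mulmxBl [leRHS]mxE [X in _ + X]mxE lerBrDr.
  have hA : (V *m map_mx toC A *m V^t*) i i <= toC (x - e).
    by rewrite eA; apply: (quad_form_le i uPA uV VA) => j; rewrite inE.
  have hB : toC x <= (V *m map_mx toC B *m V^t*) i i.
    by rewrite eB; apply: (quad_form_ge i uPB uV VB) => j; rewrite !inE -ltNge => /ltW.
  apply: le_trans hB; have -> : toC x = toC e + toC (x - e) by rewrite -rmorphD addrC subrK.
  by rewrite lerD2l.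
(* The exponent 3 splits here: [e ^+ 2] cancels and [\rank K <= n * e] remains, which is the
   vertical slack [e] of the Levy distance after division by [n]. *)
have : (\rank K)%:R * e ^+ 2 <= n%:R * e * e ^+ 2.
  apply: (le_trans h); rewrite -mulrA -exprS; apply: le_trans frobAB.
  apply: ler_sum => i _; apply: ler_sum => j _.
  by rewrite !mxE -sqrrN opprB.
rewrite ler_pM2r ?exprn_gt0 // => {}h.
apply: (le_trans (y := (\rank K + #|SB|)%:R)); first by rewrite ler_nat.
by rewrite natrD addrC lerD2l.
Qed.

Lemma esd_le n (A B : 'M[R]_n) (e x : R) :
  A^T = A -> B^T = B -> 0 < e -> frobsq (A - B) <= n%:R * e ^+ 3 ->
  esd A (x - e) - e <= esd B x.
Proof.
move=> sA sB e0 h; rewrite lerBlDr /esd.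
(* For [n = 0] the division by [0] makes both distributions [0]. *)
case: n A B sA sB h => [|n] A B sA sB h; first by rewrite invr0 !mulr0 add0r ltW.
have n0 : 0 < n.+1%:R :> R by rewrite ltr0n.
rewrite -(ler_pM2r n0) mulrDl !divfK ?gt_eqF // [e * _]mulrC.
exact: count_eig_le.
Qed.

End SymmetricSpectrum.

Section Levy.
Variable R : realType.
Implicit Types F G H : R -> R.

(** The condition whose infimum over [e] is [levy]. As a predicate it can be reversed and composed,
    and a witness guards against the default value of [inf] on an empty set. *)
Definition levy_near F G (e : R) := 0 < e /\ forall x, F (x - e) - e <= G x /\ G x <= F (x + e) + e.

Lemma levy_le F G e : levy_near F G e -> levy F G <= e.
Proof. by move=> h; apply: ge_inf => //; exists 0 => x [/ltW]. Qed.

Lemma levy_near_sym F G e : levy_near F G e -> levy_near G F e.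
Proof.
case=> e0 h; split=> // x; split.
- by rewrite lerBlDr; have [_] := h (x - e); rewrite subrK.
- by rewrite -lerBlDr; have [] := h (x + e); rewrite addrK.
Qed.

Lemma levy_near_trans F G H e f :
  levy_near F G e -> levy_near G H f -> levy_near F H (e + f).
Proof.
case=> e0 h [f0 k]; split=> [|x]; first exact: addr_gt0.
have [h1 _] := h (x - f); have [k1 k2] := k x; have [_ h2] := h (x + f).
have -> : x - (e + f) = x - f - e by ring.
have -> : x + (e + f) = x + f + e by ring.
by split; lra.
Qed.

Lemma levy_triangle F G H :
  (exists e, levy_near F G e) -> (exists e, levy_near G H e) ->
  levy F H <= levy F G + levy G H.
Proof.
move=> [e0 he0] [f0 hf0]; rewrite -lerBlDl.
apply: lb_le_inf; first by exists f0.
move=> f hf; rewrite lerBlDl -lerBlDr.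
apply: lb_le_inf; first by exists e0.
move=> e he; rewrite lerBlDr; apply: levy_le; exact: levy_near_trans he hf.
Qed.

Lemma levy_near_esd n (A B : 'M[R]_n) e : A^T = A -> B^T = B -> 0 < e ->
  frobsq (A - B) <= n%:R * e ^+ 3 -> levy_near (esd A) (esd B) e.
Proof.
move=> sA sB e0 h; split=> // x; split; first exact: esd_le.
rewrite -lerBlDr -[x in esd B x](addrK e); apply: esd_le => //.
apply: le_trans h; apply: ler_sum => i _; apply: ler_sum => j _.
by rewrite !mxE -sqrrN opprB.
Qed.

Lemma frobsq_ge0 n (A : 'M[R]_n) : 0 <= frobsq A.
Proof. by apply: sumr_ge0 => i _; apply: sumr_ge0 => j _; exact: sqr_ge0. Qed.

(** Shows that the infimum in [levy] is over a nonempty set, as [levy_triangle] requires. With [f]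
    the squared norm, [e = 1 + f] gives [f <= e ^+ 3 <= n * e ^+ 3]. *)
Lemma levy_near_esd_ex n (A B : 'M[R]_n) : (0 < n)%N -> A^T = A -> B^T = B ->
  exists e, levy_near (esd A) (esd B) e.
Proof.
move=> n0 sA sB; have f0 := frobsq_ge0 (A - B).
exists (1 + frobsq (A - B)); apply: levy_near_esd => //; first by lra.
have n1 : 1 <= n%:R :> R by rewrite ler1n.
move: f0; set f := frobsq _ => f0.
have : f <= (1 + f) ^+ 3 by rewrite !exprS expr0; nra.
have : 0 <= (1 + f) ^+ 3 by rewrite exprn_ge0 //; lra.
nra.
Qed.

End Levy.

(** * Measurability of the Levy event *)

Section LevyMeasurable.
Variables (R : realType) (d : measure_display) (T : measurableType d).

Lemma measurable_frobsq n (A : T -> 'M[R]_n) :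
  (forall i j, measurable_fun setT (fun w => A w i j)) ->
  measurable_fun setT (fun w => frobsq (A w)).
Proof.
move=> mA; apply: measurable_sum => i; apply: measurable_sum => j.
exact: measurable_funX.
Qed.

Lemma rational_approx (r : R) : 0 < r -> exists c : R -> rat, forall x, `|x - ratr (c x)| < r.
Proof.
move=> r0; suff /choice[c hc] : forall x, exists q : rat, `|x - ratr q| < r by exists c.
move=> x; have /rat_in_itvoo[q] : x - r < x + r by lra.
rewrite in_itv /= => /andP[q1 q2]; exists q.
by rewrite ltr_norml; lra.
Qed.

(* The Levy distance between spectral distributions is continuous on symmetric
   matrices, so that the event is a union over pairs of rational matrices. *)
Lemma measurable_levy_gt n (A B : T -> 'M[R]_n) (eps : R) : (0 < n)%N ->
  (forall w, (A w)^T = A w) -> (forall w, (B w)^T = B w) ->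
  (forall i j, measurable_fun setT (fun w => A w i j)) ->
  (forall i j, measurable_fun setT (fun w => B w i j)) ->
  measurable [set w | eps < levy (esd (A w)) (esd (B w))].
Proof.
move=> n0 sA sB mA mB.
pose L (M N : 'M[R]_n) := levy (esd M) (esd N).
pose q (Q : 'M[rat]_n) : 'M[R]_n := map_mx ratr Q.
pose dl (k : nat) : R := k.+1%:R^-1.
have dl0 k : 0 < dl k by rewrite invr_gt0.
pose I := ('M[rat]_n * 'M[rat]_n * nat)%type.
(* On [E u] the rational matrices are within [dl] of [A w] and [B w] in Levy distance, so a margin
   of [2 * dl] on the rational pair forces the event at [w]. *)
pose ok (u : I) := [/\ (q u.1.1)^T = q u.1.1, (q u.1.2)^T = q u.1.2 &
   eps + 2 * dl u.2 < L (q u.1.1) (q u.1.2)].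
pose E (u : I) := [set w | frobsq (A w - q u.1.1) <= n%:R * dl u.2 ^+ 3] `&`
                 [set w | frobsq (B w - q u.1.2) <= n%:R * dl u.2 ^+ 3].
have Lsym M N : M^T = M -> N^T = N -> L M N <= L N M.
  move=> sM sN; apply: lb_le_inf; first exact: levy_near_esd_ex.
  by move=> e he; apply: levy_le; exact: levy_near_sym.
have Ltri M N K : M^T = M -> N^T = N -> K^T = K -> L M K <= L M N + L N K.
  by move=> sM sN sK; apply: levy_triangle; exact: levy_near_esd_ex.
rewrite [X in measurable X](_ : _ = \bigcup_(u in ok) E u); last first.
  apply/seteqP; split => w /=.
  (* Of [4 * dl], two are lost in replacing [A w] and [B w] by rational matrices, and two are the
     margin in [ok]. *)
  - move=> h; have [k hk] : exists k, 4 * dl k < L (A w) (B w) - eps.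
      have [k _ /(_ k (leqnn k))] : \forall k \near \oo, dl k < (L (A w) (B w) - eps) / 4.
        by apply: (near_infty_natSinv_lt (PosNum _)); rewrite divr_gt0 ?subr_gt0.
      by rewrite ltr_pdivlMr // mulrC; exists k.
    (* This precision is at most 1, so it also bounds the squared errors, and [n ^ 2] of them sum to
       at most [n * dl ^+ 3]. *)
    have [c hc] : exists c : R -> rat, forall x, `|x - ratr (c x)| < dl k ^+ 3 / n%:R.
      by apply: rational_approx; rewrite divr_gt0 ?exprn_gt0 // ltr0n.
    have cS (M : 'M[R]_n) : M^T = M -> (q (map_mx c M))^T = q (map_mx c M).
      by move=> sM; apply/matrixP => i j; rewrite !mxE -[in RHS]sM mxE.
    have cN (M : 'M[R]_n) : frobsq (M - q (map_mx c M)) <= n%:R * dl k ^+ 3.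
      apply: (le_trans (y := \sum_(i < n) \sum_(j < n) dl k ^+ 3 / n%:R)).
        apply: ler_sum => i _; apply: ler_sum => j _.
        rewrite !mxE -real_normK ?num_real // expr2.
        have h1 := hc (M i j); have h0 := normr_ge0 (M i j - ratr (c (M i j))).
        have : dl k ^+ 3 / n%:R <= 1.
          rewrite ler_pdivrMr ?ltr0n // mul1r.
          have : (1 : R) <= n%:R by rewrite ler1n.
          by apply: le_trans; rewrite exprn_ile1 ?(ltW (dl0 k)) // /dl invf_le1 ?ltr0n // ler1n.
        by nra.
      rewrite !sumr_const card_ord mulr_natl lerMn2r; apply/orP; right.
      by rewrite -[leLHS]mulr_natr divfK // pnatr_eq0 -lt0n.
    exists (map_mx c (A w), map_mx c (B w), k); last by split => /=; exact: cN.
    split => /=; [exact: cS|exact: cS|].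
    have LA : L (A w) (q (map_mx c (A w))) <= dl k.
      exact: levy_le (levy_near_esd (sA w) (cS _ (sA w)) (dl0 k) (cN (A w))).
    have LB : L (B w) (q (map_mx c (B w))) <= dl k.
      exact: levy_le (levy_near_esd (sB w) (cS _ (sB w)) (dl0 k) (cN (B w))).
    have := Ltri _ _ _ (sA w) (cS _ (sA w)) (sB w).
    have := Ltri _ _ _ (cS _ (sA w)) (cS _ (sB w)) (sB w).
    have := Lsym _ _ (cS _ (sB w)) (sB w).
    move: LA LB hk; clear -eps dl; move: (dl k); clear dl.
    by move: (L _ _) (L _ _) (L _ _) (L _ _) (L _ _) (L _ _) => *; lra.
  - move=> [[[Q1 Q2] k]] /= [s1 s2 h] [h1 h2].
    have LA : L (A w) (q Q1) <= dl k := levy_le (levy_near_esd (sA w) s1 (dl0 k) h1).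
    have LB : L (B w) (q Q2) <= dl k := levy_le (levy_near_esd (sB w) s2 (dl0 k) h2).
    have T1 := Lsym _ _ s1 (sA w).
    have T2 := Ltri _ _ _ s1 (sA w) s2.
    have T3 := Ltri _ _ _ (sA w) (sB w) s2.
    suff : eps < L (A w) (B w) by [].
    move: h LA LB T1 T2 T3; move: (dl k).
    by move: (L _ _) (L _ _) (L _ _) (L _ _) (L _ _) => *; lra.
rewrite bigcup_mkcond; apply: countable_bigcupT_measurable => [|u]; first exact: countableP.
have mE (M : T -> 'M[R]_n) (Q : 'M[R]_n) c :
    (forall i j, measurable_fun setT (fun w => M w i j)) ->
    measurable [set w | frobsq (M w - Q) <= c].
  move=> mM; have mf : measurable_fun setT (fun w => frobsq (M w - Q)).
    apply: measurable_frobsq => i j.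
    rewrite (_ : (fun w => _) = (fun w => M w i j - Q i j)); last first.
      by apply/funext => w; rewrite !mxE.
    exact: measurable_funB.
  rewrite -[X in measurable X]setTI.
  exact: (mf measurableT `]-oo, c]%classic (measurable_itv _)).
by case: ifP => // _; apply: measurableI; exact: mE.
Qed.
End LevyMeasurable.

(** * Decoupling independent samples *)

Section BoundedIntegral.
Context (R : realType) (d : measure_display) (T : measurableType d) (P : probability T R).

Lemma bounded_integrable (f : T -> R) M : measurable_fun setT f ->
  (forall x, `|f x| <= M) -> P.-integrable setT (EFin \o f).
Proof.
move=> mf bf; apply: measurable_bounded_integrable => //.
  by rewrite ltey_eq fin_num_measure.
exists M; split; first exact: num_real.
by move=> x Mx u _; exact: le_trans (bf u) (ltW Mx).
Qed.

Lemma Rintegral_cst_probability (c : R) : \int[P]_w c = c.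
Proof.
rewrite Rintegral_cst // (_ : fine _ = 1) ?mulr1 //.
by rewrite -[RHS]/(fine (1%:E : \bar R)); congr fine; exact: probability_setT.
Qed.

Lemma normr_Rintegral_le (f : T -> R) M : measurable_fun setT f ->
  (forall x, `|f x| <= M) -> `|\int[P]_w f w| <= M.
Proof.
move=> mf bf; have intf := bounded_integrable mf bf.
apply: (le_trans (le_normr_Rintegral _ intf)) => //.
rewrite -[leRHS]Rintegral_cst_probability; apply: le_Rintegral => //.
- apply: (@bounded_integrable _ M); first exact: measurableT_comp.
  by move=> x; rewrite normr_id.
- by apply: (@bounded_integrable _ `|M|).
Qed.

End BoundedIntegral.

Section Decoupling.
Context (R : realType) (d : measure_display) (T : measurableType d) (P : probability T R).
Variables G1 G2 : set (set T).
Hypotheses (mG1 : G1 `<=` measurable) (mG2 : G2 `<=` measurable).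
Hypotheses (IG1 : setI_closed G1) (IG2 : setI_closed G2).
Hypotheses (TG1 : G1 setT) (TG2 : G2 setT).
Hypothesis indep : forall A B, G1 A -> G2 B -> P (A `&` B) = (P A * P B)%E.

Let sub1 : <<s G1 >> `<=` measurable.
Proof. by apply: smallest_sub => //; exact: sigma_algebra_measurable. Qed.
Let sub2 : <<s G2 >> `<=` measurable.
Proof. by apply: smallest_sub => //; exact: sigma_algebra_measurable. Qed.

(** For fixed [B] both sides are finite measures in [A] that agree on the pi-system [G1], hence on
    the sigma-algebra it generates. [indep_sigma] repeats the argument in [B]. *)
Lemma indep_sigma_l A B : <<s G1 >> A -> G2 B -> P (A `&` B) = (P A * P B)%E.
Proof.
move=> sA GB.
have fB : (0 <= fine (P B))%R by rewrite fine_ge0.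
pose c : {nonneg R} := NngNum fB.
have mB := mG2 GB.
have cE E : (P E * P B = mscale c P E)%E.
  by rewrite /mscale /= muleC fineK // fin_num_measure.
rewrite cE.
apply: (@g_sigma_algebra_measure_unique _ R T G1 mG1 (fun _ => setT) _ _ (mrestr P mB) (mscale
    c P)) => //.
- by rewrite bigcup_const.
- by move=> E GE; rewrite -[RHS]cE; exact: indep.
- by move=> _; rewrite /= /mrestr ltey_eq fin_num_measure //; exact: measurableI.
Qed.

Lemma indep_sigma A B : <<s G1 >> A -> <<s G2 >> B -> P (A `&` B) = (P A * P B)%E.
Proof.
move=> sA sB.
have fA : (0 <= fine (P A))%R by rewrite fine_ge0.
pose c : {nonneg R} := NngNum fA.
have mA := sub1 sA.
have cE E : (P A * P E = mscale c P E)%E.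
  by rewrite /mscale /= fineK // fin_num_measure.
rewrite cE setIC.
apply: (@g_sigma_algebra_measure_unique _ R T G2 mG2 (fun _ => setT) _ _ (mrestr P mA) (mscale
    c P)) => //.
- by rewrite bigcup_const.
- by move=> E GE; rewrite -[RHS]cE /= /mrestr setIC; exact: indep_sigma_l.
- by move=> _; rewrite /= /mrestr ltey_eq fin_num_measure //; exact: measurableI.
Qed.

Local Notation T1 := (g_sigma_algebraType G1).
Local Notation T2 := (g_sigma_algebraType G2).

Let mid1 : measurable_fun [set: T] (fun w => w : T1).
Proof. by move=> _ A mA; rewrite setTI; exact: sub1. Qed.
Let mid2 : measurable_fun [set: T] (fun w => w : T2).
Proof. by move=> _ A mA; rewrite setTI; exact: sub2. Qed.
Let mdiag : measurable_fun [set: T] (fun w => (w, w) : T1 * T2).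
Proof. exact: measurable_fun_pair. Qed.

(** The identity, read as a map from [T] to [T] with a coarser sigma-algebra, has the restriction of
    [P] as its law. Independence then says that the law of [diag] is the product of the laws of
    [id1] and [id2]. *)
Let id1 : {mfun T >-> T1} := MeasurableFun.Pack (MeasurableFun.Class (isMeasurableFun.Build _ _
    _ _ _ mid1)).
Let id2 : {mfun T >-> T2} := MeasurableFun.Pack (MeasurableFun.Class (isMeasurableFun.Build _ _
    _ _ _ mid2)).
Let diag : {mfun T >-> (T1 * T2)%type} := MeasurableFun.Pack (MeasurableFun.Class
    (isMeasurableFun.Build _ _ _ _ _ mdiag)).

Section Fubini.
Variables (f : T -> T -> R) (M : R).
Hypothesis mf : measurable_fun setT (fun z : T1 * T2 => f z.1 z.2).
Hypothesis bf : forall a b, `|f a b| <= M.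

Let mfE : measurable_fun setT (fun z : T1 * T2 => (f z.1 z.2)%:E).
Proof. exact/measurable_EFinP. Qed.

Let inner b : (\int[distribution P id1]_a (f a b)%:E = \int[P]_a (f a b)%:E)%E.
Proof.
have ma : measurable_fun [set: T1] (fun a => f a b).
  exact: (measurableT_comp mf (@pair2_measurable _ _ T1 T2 b)).
rewrite integral_distribution //; first exact/measurable_EFinP.
by apply: (@bounded_integrable _ _ _ _ _ M) => //; exact: (measurableT_comp ma).
Qed.

Lemma decoupling_measurable : measurable_fun setT (fun b : T2 => \int[P]_a f a b).
Proof.
have mG := @measurable_fubini_G _ _ T1 T2 R (distribution P id1) (distribution P id2)
  _ (@bounded_integrable _ _ _ (distribution P id1 \x distribution P id2)%E _ M mf _).
rewrite (_ : (fun b : T2 => _) =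
  fine \o fubini_G (distribution P id1) (fun z : T1 * T2 => (f z.1 z.2)%:E)).
  by apply: measurableT_comp => //; apply: mG => -[].
by apply/funext => b; rewrite /= /fubini_G /= inner.
Qed.

(** The point [(w, w)] has the product law on [T1 * T2], so Fubini separates the two arguments. *)
Lemma decoupling : \int[P]_w f w w = \int[P]_b \int[P]_a f a b.
Proof.
congr fine.
transitivity (\int[distribution P diag]_z (f z.1 z.2)%:E)%E.
  rewrite integral_distribution //; apply: (@bounded_integrable _ _ _ _ _ M) => //.
  exact: (measurableT_comp mf mdiag).
transitivity (\int[distribution P id1 \x distribution P id2]_z (f z.1 z.2)%:E)%E.
  apply: eq_measure_integral => A mA _; apply/esym/product_measure_unique => // B C mB mC.
  exact: indep_sigma.
have i12 : (distribution P id1 \x distribution P id2)%E.-integrable setT (fun z : T1 * T2 => (f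
    z.1 z.2)%:E).
  by apply: (@bounded_integrable _ _ _ _ _ M) => // -[].
rewrite -integral21_prod_meas1 // /fubini_G /=.
under eq_integral do rewrite inner.
have bi b : `|\int[P]_a f a b| <= M.
  apply: normr_Rintegral_le => //.
  exact: (measurableT_comp (measurableT_comp mf (@pair2_measurable _ _ T1 T2 b)) mid1).
have eqi b : (\int[P]_a (f a b)%:E)%E = (\int[P]_a f a b)%:E.
  rewrite fineK // integrable_fin_num //; apply: (@bounded_integrable _ _ _ _ _ M) => //.
  exact: (measurableT_comp (measurableT_comp mf (@pair2_measurable _ _ T1 T2 b)) mid1).
under eq_integral do rewrite eqi.
rewrite integral_distribution //; first by apply/measurable_EFinP; exact: decoupling_measurable.
apply: (@bounded_integrable _ _ _ _ _ M) => //; exact: (measurableT_comp decoupling_measurable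
    mid2).
Qed.

End Fubini.

End Decoupling.

Section SampleSigmaAlgebras.
Context (R : realType) (d : measure_display) (T : measurableType d) (P : probability T R).
Context (n p : nat) (X : 'I_n -> 'I_p -> T -> R).
Hypothesis mX : forall i k, measurable_fun setT (X i k).
Hypothesis indX : indep_vectors P X.
Implicit Type S : {pred 'I_n}.

Definition rectangle (B : 'I_n -> 'I_p -> set R) : set T :=
  \bigcap_(i in [set: 'I_n]) \bigcap_(k in [set: 'I_p]) (X i k @^-1` B i k).

(** Generates the sigma-algebra of the samples with index in [S]. Rectangles over all indices,
    unconstrained outside [S], have the shape that [indep_vectors] speaks of and are closed under
    intersection. *)
Definition sample_rectangles (S : {pred 'I_n}) : set (set T) :=
  [set D | exists B : 'I_n -> 'I_p -> set R,
    [/\ forall i k, measurable (B i k), forall i k, i \notin S -> B i k = setT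
      & D = rectangle B]].

Lemma measurable_sample_rectangles S : sample_rectangles S `<=` measurable.
Proof.
move=> D [B [mB _ ->]]; apply: fin_bigcap_measurable => // i _.
apply: fin_bigcap_measurable => // k _.
by rewrite -[X in measurable X]setTI; exact: mX.
Qed.

Lemma setI_closed_sample_rectangles S : setI_closed (sample_rectangles S).
Proof.
move=> _ _ [B [mB SB ->]] [C [mC SC ->]].
exists (fun i k => B i k `&` C i k); split.
- by move=> i k; exact: measurableI.
- by move=> i k iS; rewrite SB // SC // setIT.
- rewrite /rectangle -bigcapI; apply: eq_bigcapr => i _.
  by rewrite -bigcapI.
Qed.

Lemma setT_sample_rectangles S : sample_rectangles S setT.
Proof.
exists (fun _ _ => setT); split => //.
by apply/seteqP; split => // w _ i _ k _.
Qed.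

(** The intersection is again a rectangle, and its probability splits over the indices. At each
    index at least one of the two rectangles is unconstrained and contributes the factor 1. *)
Lemma indep_sample_rectangles S S' A B : (forall i, i \in S -> i \notin S') ->
  sample_rectangles S A -> sample_rectangles S' B -> P (A `&` B) = (P A * P B)%E.
Proof.
move=> dS [C [mC SC ->]] [D [mD SD ->]].
have -> : rectangle C `&` rectangle D = rectangle (fun i k => C i k `&` D i k).
  rewrite /rectangle -bigcapI; apply: eq_bigcapr => i _.
  by rewrite -bigcapI.
rewrite /rectangle !indX // => [|i k]; last exact: measurableI.
rewrite -big_split /=; apply: eq_bigr => i _.
have PT E : (forall k, E k = setT) ->
    P (\bigcap_(k in [set: 'I_p]) (X i k @^-1` E k)) = 1%E.
  move=> ET; rewrite (_ : \bigcap_(k in _) _ = setT) ?probability_setT //.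
  by apply/seteqP; split => // w _ k _; rewrite /= ET.
have [iS|iS] := boolP (i \in S).
  have iS' := dS _ iS.
  rewrite (PT (D i)) ?mule1; last by move=> k; exact: SD.
  by congr (P _); apply: eq_bigcapr => k _; rewrite SD // setIT.
rewrite (PT (C i)) ?mul1e; last by move=> k; exact: SC.
by congr (P _); apply: eq_bigcapr => k _; rewrite SC // setTI.
Qed.

Lemma measurable_sample S i k : i \in S ->
  measurable_fun setT (X i k : g_sigma_algebraType (sample_rectangles S) -> R).
Proof.
move=> iS _ B mB; rewrite setTI; apply: sub_sigma_algebra.
exists (fun i' k' => if (i' == i) && (k' == k) then B else setT); split.
- by move=> i' k'; case: ifP.
- by move=> i' k' i'S; case: ifP => // /andP[/eqP ii']; rewrite -ii' (negbTE i'S) in iS.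
- apply/seteqP; split => w /=.
  + by move=> Bw i' _ k' _ /=; case: ifP => // /andP[/eqP -> /eqP ->].
  + by move=> /(_ i Logic.I k Logic.I) /=; rewrite !eqxx.
Qed.

Lemma decoupling_sample S S' (f : T -> T -> R) M : (forall i, i \in S -> i \notin S') ->
  measurable_fun setT (fun z : g_sigma_algebraType (sample_rectangles S) *
    g_sigma_algebraType (sample_rectangles S') => f z.1 z.2) ->
  (forall a b, `|f a b| <= M) ->
  \int[P]_w f w w = \int[P]_b \int[P]_a f a b.
Proof.
move=> dS mf bf.
apply: (@decoupling _ _ _ P _ _ (@measurable_sample_rectangles S)
  (@measurable_sample_rectangles S') (@setI_closed_sample_rectangles S)
  (@setI_closed_sample_rectangles S') (setT_sample_rectangles S)
  (setT_sample_rectangles S') _ f M) => // A B.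
exact: indep_sample_rectangles.
Qed.

Lemma decoupling_sample_measurable S S' (f : T -> T -> R) M :
  measurable_fun setT (fun z : g_sigma_algebraType (sample_rectangles S) *
    g_sigma_algebraType (sample_rectangles S') => f z.1 z.2) ->
  (forall a b, `|f a b| <= M) ->
  measurable_fun setT (fun b : g_sigma_algebraType (sample_rectangles S') => \int[P]_a f a b).
Proof.
move=> mf bf.
exact: (@decoupling_measurable _ _ _ P _ _ (@measurable_sample_rectangles S)
  (@measurable_sample_rectangles S') f M).
Qed.

(** The working form of conditioning: the samples in [S'] are frozen and those in [S] integrated.
    With [c = 0] it yields orthogonality relations. *)
Lemma decoupling_bound S S' (f : T -> T -> R) M c : (forall i, i \in S -> i \notin S') ->
  measurable_fun setT (fun z : g_sigma_algebraType (sample_rectangles S) *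
    g_sigma_algebraType (sample_rectangles S') => f z.1 z.2) ->
  (forall a b, `|f a b| <= M) ->
  (forall b, `|\int[P]_a f a b| <= c) ->
  `|\int[P]_w f w w| <= c.
Proof.
move=> dS mf bf bc; rewrite (decoupling_sample dS mf bf).
apply: normr_Rintegral_le => //.
move=> _ B mB; have := decoupling_sample_measurable mf bf measurableT mB.
apply: smallest_sub => //; first exact: sigma_algebra_measurable.
exact: measurable_sample_rectangles.
Qed.

End SampleSigmaAlgebras.

(** * Integrals of bounded measurable functions *)

Section BoundedFunctions.
Context (R : realType) (d : measure_display) (T : measurableType d).

Definition bounded_measurable (f : T -> R) :=
  measurable_fun setT f /\ exists M, forall x, `|f x| <= M.

Lemma bounded_measurable_integrable (P : probability T R) f :
  bounded_measurable f -> P.-integrable setT (EFin \o f).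
Proof. by move=> [mf [M bf]]; exact: bounded_integrable bf. Qed.

Lemma bounded_measurable_cst c : bounded_measurable (fun=> c).
Proof. by split=> //; exists `|c|. Qed.

Lemma bounded_measurableD f g : bounded_measurable f -> bounded_measurable g ->
  bounded_measurable (fun x => f x + g x).
Proof.
move=> [mf [M bf]] [mg [N bg]]; split; first exact: measurable_funD.
by exists (M + N) => x; rewrite (le_trans (ler_normD _ _)) // lerD.
Qed.

Lemma bounded_measurableM f g : bounded_measurable f -> bounded_measurable g ->
  bounded_measurable (fun x => f x * g x).
Proof.
move=> [mf [M bf]] [mg [N bg]]; split; first exact: measurable_funM.
by exists (M * N) => x; rewrite normrM ler_pM.
Qed.

Lemma bounded_measurableN f : bounded_measurable f -> bounded_measurable (fun x => - f x).
Proof.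
move=> [mf [M bf]]; split; first exact: measurableT_comp.
by exists M => x; rewrite normrN.
Qed.

Lemma bounded_measurableB f g : bounded_measurable f -> bounded_measurable g ->
  bounded_measurable (fun x => f x - g x).
Proof. by move=> bf bg; apply: bounded_measurableD => //; exact: bounded_measurableN. Qed.

Lemma bounded_measurable_sum I (r : seq I) (Q : pred I) (F : I -> T -> R) :
  (forall i, Q i -> bounded_measurable (F i)) ->
  bounded_measurable (fun x => \sum_(i <- r | Q i) F i x).
Proof.
move=> bF; elim: r => [|i r IHr].
  by under eq_fun do rewrite big_nil; exact: bounded_measurable_cst.
have [Qi|/negbTE Qi] := boolP (Q i); under eq_fun do rewrite big_cons Qi.
  by apply: bounded_measurableD => //; exact: bF.
exact: IHr.
Qed.

Variable P : probability T R.

Lemma Rintegral_sum I (r : seq I) (Q : pred I) (F : I -> T -> R) :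
  (forall i, Q i -> bounded_measurable (F i)) ->
  \int[P]_x (\sum_(i <- r | Q i) F i x) = \sum_(i <- r | Q i) \int[P]_x F i x.
Proof.
move=> bF; elim: r => [|i r IHr].
  rewrite big_nil -[RHS](@Rintegral_cst_probability _ _ _ P).
  by apply: eq_Rintegral => x _; rewrite big_nil.
rewrite big_cons.
have [Qi|Qi] := boolP (Q i); last first.
  by rewrite -IHr; apply: eq_Rintegral => x _; rewrite big_cons (negbTE Qi).
rewrite -IHr -RintegralD //.
- by apply: eq_Rintegral => x _; rewrite big_cons Qi.
- by apply: bounded_measurable_integrable; exact: bF.
- by apply: bounded_measurable_integrable; exact: bounded_measurable_sum.
Qed.

Lemma bounded_convergence (f_ : nat -> T -> R) (f : T -> R) M :
  (forall n, measurable_fun setT (f_ n)) -> measurable_fun setT f ->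
  (forall n x, `|f_ n x| <= M) -> (forall x, f_ ^~ x @ \oo --> f x) ->
  (fun n => \int[P]_x f_ n x) @ \oo --> \int[P]_x f x.
Proof.
move=> mf_ mf bf cf.
have bfl x : `|f x| <= M.
  by apply: (cvgr_to_le (cvg_norm (cf x))); exact: nearW.
have := @dominated_convergence _ T R P _ measurableT (fun n x => (f_ n x)%:E) (fun x => (f
    x)%:E) (cst M%:E).
case.
- by move=> n; exact/measurable_EFinP.
- exact/measurable_EFinP.
- by apply: aeW => x _; apply: cvg_EFin; [exact: nearW|exact: cf].
- apply: (@bounded_measurable_integrable P (cst M)); exact: bounded_measurable_cst.
- by apply: aeW => x n _; rewrite lee_fin.
move=> _ _ h; apply: fine_cvg; rewrite fineK //.
apply: integrable_fin_num => //; exact: bounded_integrable bfl.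
Qed.

Lemma eq_law_Rintegral d' (T' : measurableType d') (P' : probability T' R)
    (f : T -> R) (g : T' -> R) (phi : R -> R) M :
  measurable_fun setT f -> measurable_fun setT g -> measurable_fun setT phi ->
  (forall x, `|phi x| <= M) ->
  (forall B, measurable B -> P (f @^-1` B) = P' (g @^-1` B)) ->
  \int[P]_x phi (f x) = \int[P']_x phi (g x).
Proof.
move=> mf mg mphi bphi fg.
pose f' : {mfun T >-> R} := MeasurableFun.Pack (MeasurableFun.Class (isMeasurableFun.Build _ _
    _ _ _ mf)).
pose g' : {mfun T' >-> R} := MeasurableFun.Pack (MeasurableFun.Class (isMeasurableFun.Build _ _
    _ _ _ mg)).
congr fine.
transitivity (\int[distribution P f']_u (phi u)%:E)%E.
  rewrite integral_distribution //; first exact/measurable_EFinP.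
  by apply: (@bounded_integrable _ _ _ _ _ M) => //; exact: measurableT_comp.
transitivity (\int[distribution P' g']_u (phi u)%:E)%E.
  by apply: eq_measure_integral => B mB _; exact: fg.
rewrite integral_distribution //; first exact/measurable_EFinP.
by apply: (@bounded_integrable _ _ _ _ _ M) => //; exact: measurableT_comp.
Qed.

Lemma Fubini_probability d' (T' : measurableType d') (P' : probability T' R)
    (f : T -> T' -> R) M :
  measurable_fun setT (fun z : T * T' => f z.1 z.2) -> (forall a b, `|f a b| <= M) ->
  \int[P]_a \int[P']_b f a b = \int[P']_b \int[P]_a f a b.
Proof.
move=> mf bf.
have ib : (P \x P')%E.-integrable setT (fun z : T * T' => (f z.1 z.2)%:E).
  by apply: (@bounded_integrable _ _ _ _ _ M) => // -[].
have := Fubini ib => /= h.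
have e1 a : (\int[P']_b (f a b)%:E)%E = (\int[P']_b f a b)%:E.
  rewrite fineK // integrable_fin_num //; apply: (@bounded_integrable _ _ _ _ _ M) => //.
  exact: (measurableT_comp mf (pair1_measurable a)).
have e2 b : (\int[P]_a (f a b)%:E)%E = (\int[P]_a f a b)%:E.
  rewrite fineK // integrable_fin_num //; apply: (@bounded_integrable _ _ _ _ _ M) => //.
  exact: (measurableT_comp mf (pair2_measurable b)).
congr fine; rewrite -[LHS](_ : (\int[P]_a \int[P']_b (f a b)%:E)%E = _); last first.
  by apply: eq_integral => a _; rewrite e1.
by rewrite h; apply: eq_integral => b _; rewrite e2.
Qed.

End BoundedFunctions.

(** * Sign symmetry of Gaussian residuals *)

Section SignApproximation.
Variable R : realType.
Implicit Types u v : R.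

(* An odd cubic with fixed points [-1, 0, 1]: its iterates are polynomials that
   converge boundedly to the sign on [-1, 1]. *)
Definition cubic_step v : R := (3 * v - v ^+ 3) / 2.

Lemma cubic_stepN v : cubic_step (- v) = - cubic_step v.
Proof. by rewrite /cubic_step; field. Qed.

Lemma iter_cubic_stepN m v : iter m cubic_step (- v) = - iter m cubic_step v.
Proof. by elim: m => //= m ->; rewrite cubic_stepN. Qed.

Lemma cubic_step_itv v : 0 <= v <= 1 -> v <= cubic_step v <= 1.
Proof.
move=> /andP[v0 v1].
have -> : cubic_step v = v + v * (1 - v) * (1 + v) / 2 by rewrite /cubic_step; field.
have e : 1 - (v + v * (1 - v) * (1 + v) / 2) = (1 - v) ^+ 2 * (2 + v) / 2 by field.
apply/andP; split.
  by rewrite lerDl !mulr_ge0 ?subr_ge0 // ?addr_ge0.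
by rewrite -subr_ge0 e !mulr_ge0 ?exprn_ge0 ?subr_ge0 ?addr_ge0.
Qed.

Lemma iter_cubic_step_itv m v : 0 <= v <= 1 -> v <= iter m cubic_step v <= 1.
Proof.
move=> v01; have /andP[v0 v1] := v01; elim: m => [|m /andP[h1 h2]] /=; first by rewrite lexx.
have /cubic_step_itv/andP[h3 h4] : 0 <= iter m cubic_step v <= 1.
  by rewrite h2 (le_trans v0).
by rewrite h4 (le_trans h1).
Qed.

Lemma normr_iter_cubic_step m v : `|v| <= 1 -> `|iter m cubic_step v| <= 1.
Proof.
move=> v1; wlog v0 : v v1 / 0 <= v.
  move=> h; case: (leP 0 v) => [|/ltW v0]; first exact: h.
  by rewrite -[v]opprK iter_cubic_stepN normrN; apply: h; rewrite ?normrN // oppr_ge0.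
have /(iter_cubic_step_itv m)/andP[h1 h2] : 0 <= v <= 1 by rewrite v0 -(ger0_norm v0).
by rewrite ger0_norm // (le_trans v0).
Qed.

(** By oddness take [v >= 0]. The iterates increase and stay below 1, so they converge to a root of
    [l * (1 - l) * (1 + l)] in [[v, 1]]; this is 1 unless [v = 0], when all iterates vanish. *)
Lemma iter_cubic_step_cvg v : `|v| <= 1 ->
  (fun m => iter m cubic_step v) @ \oo --> Num.sg v.
Proof.
move=> v1; wlog v0 : v v1 / 0 <= v.
  move=> h; case: (leP 0 v) => [|/ltW v0]; first exact: h.
  rewrite -[v]opprK sgrN; under eq_fun do rewrite iter_cubic_stepN.
  by apply: cvgN; apply: h; rewrite ?normrN // oppr_ge0.
have v01 : 0 <= v <= 1 by rewrite v0 -(ger0_norm v0).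
pose s m := iter m cubic_step v.
have s01 m : v <= s m <= 1 by exact: iter_cubic_step_itv.
have s_nd : nondecreasing_seq s.
  apply/nondecreasing_seqP => m; have /andP[h1 h2] := s01 m.
  by have /cubic_step_itv/andP[] : 0 <= s m <= 1 by rewrite h2 (le_trans v0).
have s_cvg : cvgn s.
  apply: nondecreasing_is_cvgn => //; exists 1 => _ [m _ <-].
  by have /andP[] := s01 m.
have sl : s @ \oo --> limn s by [].
have l1 : limn s <= 1.
  by apply: limr_le => //; apply: nearW => m; have /andP[] := s01 m.
have lv : v <= limn s.
  by apply: limr_ge => //; apply: nearW => m; have /andP[] := s01 m.
set l := limn s in sl l1 lv.
have ql : cubic_step l = l.
  have sl' : (fun m => s m.+1) @ \oo --> l by rewrite cvg_shiftS.
  have stepE v' : cubic_step v' = (3 * v' - v' * (v' * v')) * 2^-1 by rewrite /cubic_step; field.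
  have sq : (fun m => cubic_step (s m)) @ \oo --> cubic_step l.
    rewrite stepE; under eq_fun do rewrite stepE.
    apply: cvgM; last exact: cvg_cst.
    apply: cvgB; first by apply: cvgM => //; exact: cvg_cst.
    by apply: cvgM => //; exact: cvgM.
  exact: (cvg_unique _ sq sl').
have /orP[/eqP l0|/eqP l1'] : (l == 0) || (l == 1).
  have : l * (1 - l) * (1 + l) = 0.
    have -> : l * (1 - l) * (1 + l) = 2 * (cubic_step l - l) by rewrite /cubic_step; field.
    by rewrite ql subrr mulr0.
  move/eqP; rewrite !mulf_eq0 -orbA => /or3P[->//||].
    by rewrite subr_eq0 eq_sym => ->; rewrite orbT.
  by rewrite addr_eq0 => /eqP l1'; exfalso; move: lv v0 l1'; lra.
- have ve : v = 0 by apply/eqP; rewrite eq_le v0 -l0 lv.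
  by have -> : Num.sg v = l by rewrite ve sgr0 l0.
- have [ve|vne] := eqVneq v 0.
    exfalso; have : l = 0.
      apply: (cvg_unique _ sl) => //.
      rewrite (_ : s = cst 0); first exact: cvg_cst.
      apply/funext => m; rewrite /s ve; elim: m => //= m ->.
      by rewrite /cubic_step expr0n /= mulr0 subrr mul0r.
    by rewrite l1' => /eqP; rewrite oner_eq0.
  by have -> : Num.sg v = l by rewrite gtr0_sg ?lt_def ?vne.
Qed.

(** Each triple holds amplitude, frequency and phase. The phase makes sines available and keeps the
    class closed under products through [mul_cos]. *)
Definition trig_poly (f : R -> R) := exists l : seq (R * R * R),
  forall u, f u = \sum_(q <- l) q.1.1 * cos (q.1.2 * u + q.2).

Lemma trig_polyD f g : trig_poly f -> trig_poly g -> trig_poly (fun u => f u + g u).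
Proof. by move=> [l fl] [k gk]; exists (l ++ k) => u; rewrite big_cat fl gk. Qed.

Lemma trig_polyZ c f : trig_poly f -> trig_poly (fun u => c * f u).
Proof.
move=> [l fl]; exists [seq (c * q.1.1, q.1.2, q.2) | q <- l] => u.
by rewrite big_map fl mulr_sumr; apply: eq_bigr => q _; rewrite mulrA.
Qed.

Lemma mul_cos (a b : R) : cos a * cos b = (cos (a + b) + cos (a - b)) / 2.
Proof. by rewrite cosD cosB; field. Qed.

Lemma trig_polyM f g : trig_poly f -> trig_poly g -> trig_poly (fun u => f u * g u).
Proof.
move=> [l fl] [k gk].
exists (flatten [seq flatten [seq [:: (q.1.1 * r.1.1 / 2, q.1.2 + r.1.2, q.2 + r.2);
  (q.1.1 * r.1.1 / 2, q.1.2 - r.1.2, q.2 - r.2)] | r <- k] | q <- l]) => u.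
rewrite fl gk big_flatten big_map mulr_suml; apply: eq_bigr => q _.
rewrite big_flatten big_map mulr_sumr; apply: eq_bigr => r _.
rewrite !big_cons big_nil /= addr0 mulrACA mul_cos.
have -> : (q.1.2 + r.1.2) * u + (q.2 + r.2) = (q.1.2 * u + q.2) + (r.1.2 * u + r.2) by ring.
have -> : (q.1.2 - r.1.2) * u + (q.2 - r.2) = (q.1.2 * u + q.2) - (r.1.2 * u + r.2) by ring.
by field.
Qed.

(** Two limits lead to the sign of [u - a]: letting [m] grow turns the sine into a square wave, and
    letting [L] grow moves its jumps other than [a] away from any given [u]. *)
Definition sine_sign (L a : R) m u := iter m cubic_step (sin ((u - a) / L)).

Lemma trig_poly_sine_sign L a m : trig_poly (sine_sign L a m).
Proof.
elim: m => [|m IHm].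
  exists [:: (1, L^-1, - a / L - pi / 2)] => u.
  rewrite big_seq1 /= mul1r /sine_sign /= -cosBpihalf.
  by congr cos; rewrite mulrBl; ring.
have -> : sine_sign L a m.+1 = fun u => 3 / 2 * sine_sign L a m u + (- 2^-1) *
   (sine_sign L a m u * (sine_sign L a m u * sine_sign L a m u)).
  by apply/funext => u; rewrite /sine_sign /= /cubic_step; field.
apply: trig_polyD; first exact: trig_polyZ.
apply: trig_polyZ; apply: trig_polyM => //; exact: trig_polyM.
Qed.

Lemma normr_sine_sign L a m u : `|sine_sign L a m u| <= 1.
Proof. by apply: normr_iter_cubic_step; rewrite ler_norml sin_geN1 sin_le1. Qed.

Lemma sine_sign_cvg L a u :
  (fun m => sine_sign L a m u) @ \oo --> Num.sg (sin ((u - a) / L)).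
Proof. by apply: iter_cubic_step_cvg; rewrite ler_norml sin_geN1 sin_le1. Qed.

Lemma sg_sin (u : R) : `|u| < pi -> Num.sg (sin u) = Num.sg u.
Proof.
move=> upi; wlog u0 : u upi / 0 <= u.
  move=> h; case: (leP 0 u) => [u0|/ltW u0]; first exact: h.
  rewrite -[u]opprK sinN 2!sgrN; congr (- _).
  by apply: h; rewrite ?normrN // oppr_ge0.
move: u0; rewrite le_eqVlt => /orP[/eqP <-|u0]; first by rewrite sin0.
rewrite !gtr0_sg // sin_gt0_pi // u0 /=.
by move: upi; rewrite ger0_norm // ltW.
Qed.

(** The sequence is eventually constant: once [m.+1 * pi] exceeds [|u - a|], the argument lies in
    []-pi, pi[], where the sine has the sign of its argument. *)
Lemma sg_sin_cvg a u :
  (fun m : nat => Num.sg (sin ((u - a) / m.+1%:R))) @ \oo --> Num.sg (u - a).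
Proof.
apply: cvg_near_cst.
have e0 : 0 < pi / (`|u - a| + 1) :> R by rewrite divr_gt0 ?pi_gt0 // ltr_wpDl.
near=> m.
rewrite sg_sin.
  by rewrite sgrM [Num.sg _^-1]gtr0_sg ?invr_gt0 // mulr1.
have : m.+1%:R^-1 < pi / (`|u - a| + 1) :> R.
  by near: m; exact: (near_infty_natSinv_lt (PosNum e0)).
rewrite ltr_pdivlMr; last by rewrite ltr_wpDl.
move=> h.
rewrite normrM [`|_^-1|]ger0_norm ?invr_ge0 // mulrC.
apply: le_lt_trans h; rewrite ler_pM2l ?invr_gt0 // lerDl //.
Unshelve. all: by end_near.
Qed.

End SignApproximation.

Section SignSymmetry.
Variable R : realType.

Lemma sgr_nondecreasing : {homo (@Num.sg R) : a b / a <= b}.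
Proof.
move=> a b ab; case: (ltrgt0P a) => [a0|a0|a0].
- by rewrite gtr0_sg // gtr0_sg // (lt_le_trans a0).
- by rewrite ltr0_sg //; case: (sgrP b) => //; lra.
- by rewrite a0 sgr0 sgr_ge0 -a0.
Qed.

Lemma measurable_sgr : measurable_fun [set: R] (@Num.sg R).
Proof.
by apply: nondecreasing_measurable => // a b; exact: sgr_nondecreasing.
Qed.

Lemma normr_sgr_le1 (a : R) : `|Num.sg a| <= 1.
Proof. by rewrite normr_sg; case: eqP. Qed.

Lemma measurable_trig_poly f : trig_poly f -> measurable_fun [set: R] f.
Proof.
move=> [l fl]; rewrite (_ : f = fun u => \sum_(q <- l) q.1.1 * cos (q.1.2 * u + q.2)).
  apply: measurable_sum => q; apply: measurable_funM => //.
  apply: measurableT_comp; first exact: continuous_measurable_fun (@continuous_cos R).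
  by apply: measurable_funD => //; exact: measurable_funM.
exact/funext.
Qed.

Context (d : measure_display) (T : measurableType d) (P : probability T R).
Variables x z : T -> R.
Hypotheses (mx : measurable_fun setT x) (mz : measurable_fun setT z).

(** A test of the symmetry of [z] given [x], stable under bounded pointwise limits in either
    function. *)
Definition flip_invariant (f h : R -> R) :=
  \int[P]_w (f (x w) * h (z w)) = \int[P]_w (f (x w) * h (- z w)).

Lemma flip_invariant_cvgl (f_ : nat -> R -> R) (f h : R -> R) :
  (forall m, measurable_fun setT (f_ m)) -> measurable_fun setT f -> measurable_fun setT h ->
  (forall m u, `|f_ m u| <= 1) -> (forall u, `|h u| <= 1) ->
  (forall u, f_ ^~ u @ \oo --> f u) ->
  (forall m, flip_invariant (f_ m) h) -> flip_invariant f h.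
Proof.
move=> mf_ mf mh bf bh cf fi.
have key (y : T -> R) : measurable_fun setT y ->
    (fun m => \int[P]_w (f_ m (x w) * h (y w))) @ \oo --> \int[P]_w (f (x w) * h (y w)).
  move=> my; apply: (@bounded_convergence _ _ _ P _ _ 1).
  - by move=> m; apply: measurable_funM; exact: measurableT_comp.
  - by apply: measurable_funM; exact: measurableT_comp.
  - by move=> m w; rewrite normrM mulr_ile1.
  - by move=> w; apply: cvgM; [exact: cf|exact: cvg_cst].
have h1 := key z mz.
have /key h2 : measurable_fun setT (fun w => - z w) by exact: measurableT_comp.
have e : (fun m => \int[P]_w (f_ m (x w) * h (z w))) =
         (fun m => \int[P]_w (f_ m (x w) * h (- z w))) by exact/funext.
by rewrite e in h1; exact: (cvg_unique _ h1 h2).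
Qed.

Lemma flip_invariant_cvgr (f : R -> R) (h_ : nat -> R -> R) (h : R -> R) :
  (forall m, measurable_fun setT (h_ m)) -> measurable_fun setT h -> measurable_fun setT f ->
  (forall m u, `|h_ m u| <= 1) -> (forall u, `|f u| <= 1) ->
  (forall u, h_ ^~ u @ \oo --> h u) ->
  (forall m, flip_invariant f (h_ m)) -> flip_invariant f h.
Proof.
move=> mh_ mh mf bh bf ch fi.
have key (y : T -> R) : measurable_fun setT y ->
    (fun m => \int[P]_w (f (x w) * h_ m (y w))) @ \oo --> \int[P]_w (f (x w) * h (y w)).
  move=> my; apply: (@bounded_convergence _ _ _ P _ _ 1).
  - by move=> m; apply: measurable_funM; exact: measurableT_comp.
  - by apply: measurable_funM; exact: measurableT_comp.
  - by move=> m w; rewrite normrM mulr_ile1.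
  - by move=> w; apply: cvgM; [exact: cvg_cst|exact: ch].
have h1 := key z mz.
have /key h2 : measurable_fun setT (fun w => - z w) by exact: measurableT_comp.
have e : (fun m => \int[P]_w (f (x w) * h_ m (z w))) =
         (fun m => \int[P]_w (f (x w) * h_ m (- z w))) by exact/funext.
by rewrite e in h1; exact: (cvg_unique _ h1 h2).
Qed.

(** The characteristic functions of [(x, z)] and [(x, - z)] agree: [c = 0] is the real part,
    [c = - pi / 2] the imaginary part. *)
Hypothesis cos_flip : forall s t c,
  \int[P]_w cos (s * x w + t * z w + c) = \int[P]_w cos (s * x w - t * z w + c).

Let bounded_cos s t c : bounded_measurable (fun w => cos (s * x w + t * z w + c)).
Proof.
split; last by exists 1 => w; rewrite ler_norml cos_geN1 cos_le1.
apply: measurableT_comp; first exact: continuous_measurable_fun (@continuous_cos R).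
by apply: measurable_funD => //; apply: measurable_funD; exact: measurable_funM.
Qed.

Lemma flip_invariant_cos s c t e :
  flip_invariant (fun u => cos (s * u + c)) (fun u => cos (t * u + e)).
Proof.
rewrite /flip_invariant.
have E t' : \int[P]_w (cos (s * x w + c) * cos (t' * z w + e)) =
    2^-1 * (\int[P]_w cos (s * x w + t' * z w + (c + e)) +
            \int[P]_w cos (s * x w + (- t') * z w + (c - e))).
  rewrite -RintegralD // -?RintegralZl //; do ?exact: bounded_measurable_integrable.
    apply: eq_Rintegral => w _; rewrite mul_cos mulrC; congr (_ * (cos _ + cos _)); ring.
  by apply: bounded_measurable_integrable; exact: bounded_measurableD.
rewrite E; under [RHS]eq_Rintegral do rewrite mulrN -mulNr.
rewrite E opprK; congr (_ * _).
have F t' c' : \int[P]_w cos (s * x w + (- t') * z w + c') = \int[P]_w cos (s * x w + t' * z w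
    + c').
  rewrite cos_flip; apply: eq_Rintegral => w _; congr cos; ring.
by rewrite !F.
Qed.

Lemma flip_invariant_trig f h : trig_poly f -> trig_poly h -> flip_invariant f h.
Proof.
move=> [l fl] [k hk].
have bfh q r t' : bounded_measurable (fun w => cos (q.1.2 * x w + q.2) * cos (t' * z w + r : R)).
  apply: bounded_measurableM.
    have := bounded_cos q.1.2 0 q.2.
    by under eq_fun do rewrite mul0r addr0.
  have := bounded_cos 0 t' r.
  by under eq_fun do rewrite mul0r add0r.
have E (e : R) : \int[P]_w (f (x w) * h (e * z w)) = \sum_(q <- l) \sum_(r <- k)
    (q.1.1 * r.1.1) * \int[P]_w (cos (q.1.2 * x w + q.2) * cos (r.1.2 * e * z w + r.2)).
  transitivity (\int[P]_w \sum_(q <- l) \sum_(r <- k)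
    (q.1.1 * r.1.1) * (cos (q.1.2 * x w + q.2) * cos (r.1.2 * e * z w + r.2))).
    apply: eq_Rintegral => w _; rewrite fl hk mulr_suml; apply: eq_bigr => q _.
    by rewrite mulr_sumr; apply: eq_bigr => r _; rewrite mulrACA [r.1.2 * (e * _)]mulrA.
  have bZ q r : bounded_measurable (fun w => (q.1.1 * r.1.1) *
      (cos (q.1.2 * x w + q.2) * cos (r.1.2 * e * z w + r.2))).
    by apply: bounded_measurableM => //; exact: bounded_measurable_cst.
  rewrite Rintegral_sum => [|q _]; last exact: bounded_measurable_sum.
  apply: eq_bigr => q _; rewrite Rintegral_sum => [|r _]; last exact: bZ.
  by apply: eq_bigr => r _; rewrite RintegralZl //; exact: bounded_measurable_integrable.
rewrite /flip_invariant; have := E 1; under eq_Rintegral do rewrite mul1r; move=> ->.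
have := E (-1); under eq_Rintegral do rewrite mulN1r; move=> ->.
apply: eq_bigr => q _; apply: eq_bigr => r _; congr (_ * _).
rewrite mulr1 mulrN1 (flip_invariant_cos q.1.2 q.2 r.1.2 r.2).
by apply: eq_Rintegral => w _; rewrite mulrN mulNr.
Qed.

(** Four successive bounded limits start from pairs of trigonometric polynomials: iterates and then
    period for the left function, with the right one fixed, and afterwards the same on the right. *)
Lemma flip_invariant_sgr a b :
  flip_invariant (fun u => Num.sg (u - a)) (fun u => Num.sg (u - b)).
Proof.
have mss L c m : measurable_fun [set: R] (sine_sign L c m).
  by apply: measurable_trig_poly; exact: trig_poly_sine_sign.
have msin L c : measurable_fun [set: R] (fun u => Num.sg (sin ((u - c) / L))).
  apply: (measurableT_comp measurable_sgr).
  apply: measurableT_comp; first exact: continuous_measurable_fun (@continuous_sin R).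
  by apply: measurable_funM => //; exact: measurable_funB.
have msg (c : R) : measurable_fun [set: R] (fun u => Num.sg (u - c)).
  by apply: (measurableT_comp measurable_sgr); exact: measurable_funB.
have fl M m : flip_invariant (fun u => Num.sg (u - a)) (sine_sign M b m).
  apply: (@flip_invariant_cvgl (fun k u => Num.sg (sin ((u - a) / k.+1%:R)))) => //.
  - by move=> k u; exact: normr_sgr_le1.
  - exact: normr_sine_sign.
  - by move=> u; exact: sg_sin_cvg.
  move=> k; apply: (@flip_invariant_cvgl (sine_sign k.+1%:R a)) => //.
  - exact: normr_sine_sign.
  - exact: normr_sine_sign.
  - by move=> u; exact: sine_sign_cvg.
  by move=> j; apply: flip_invariant_trig; exact: trig_poly_sine_sign.
apply: (@flip_invariant_cvgr _ (fun k u => Num.sg (sin ((u - b) / k.+1%:R)))) => //.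
- by move=> k u; exact: normr_sgr_le1.
- by move=> u; exact: normr_sgr_le1.
- by move=> u; exact: sg_sin_cvg.
move=> k; apply: (@flip_invariant_cvgr _ (sine_sign k.+1%:R b)) => //.
- exact: normr_sine_sign.
- by move=> u; exact: normr_sgr_le1.
- by move=> u; exact: sine_sign_cvg.
Qed.

End SignSymmetry.

(** * The standard normal law *)

Section StandardNormal.
Variable R : realType.
Local Notation gam := (normal_prob (0 : R) 1).

(* [A_i] of the paper is [centered_rank] applied to the coordinates of [X_i]. *)
Definition centered_rank (t : R) : R := 2 * Phi t - 1.

Lemma Rintegral_indic_probability d (T : measurableType d) (P : probability T R) (A : set T) :
  measurable A -> \int[P]_w \1_A w = fine (P A).
Proof. by move=> mA; rewrite /Rintegral integral_indic // setIT. Qed.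

Lemma bounded_measurable_indic d (T : measurableType d) (A : set T) :
  measurable A -> bounded_measurable (fun w => \1_A w : R).
Proof.
move=> mA; split; first exact: measurable_indic.
by exists 1 => w; rewrite indicE; case: (_ \in _) => /=; rewrite ?normr1 ?normr0.
Qed.

Lemma measurable_le_set (t : R) : measurable [set s : R | s <= t].
Proof. by rewrite -set_itvNyc; exact: measurable_itv. Qed.

Lemma normal_prob_set1 (t : R) : gam [set t] = 0%E.
Proof.
have /null_content_dominatesP := @normal_prob_dominates R 0 1; apply => //.
exact: lebesgue_measure_set1.
Qed.

Lemma Rintegral_sgr_normal t : \int[gam]_s Num.sg (t - s) = centered_rank t.
Proof.
(* The sign vanishes at [s = t], where the indicator of [s <= t] is 1; the correction lives on a
   null set. *)
have e s : Num.sg (t - s) = 2 * \1_[set s | s <= t] s - (1 + \1_[set t] s).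
  rewrite !indicE; case: (ltrgtP s t) => st.
  - rewrite gtr0_sg ?subr_gt0 // mem_set /= ?ltW // memNset /=; last by apply/eqP; rewrite lt_eqF.
    by rewrite addr0 mulr1; lra.
  - rewrite ltr0_sg ?subr_lt0 // memNset /=; last by apply/negP; rewrite -ltNge.
    by rewrite memNset /=; [lra|apply/eqP; rewrite gt_eqF].
  - by rewrite st subrr sgr0 !mem_set //=; lra.
have b1 := @bounded_measurable_indic _ _ _ (measurable_le_set t).
have b2 := @bounded_measurable_indic _ _ _ (measurable_set1 t).
under eq_Rintegral do rewrite e.
rewrite RintegralB //; last 2 first.
- apply: bounded_measurable_integrable; apply: bounded_measurableM => //.
  exact: bounded_measurable_cst.
- apply: bounded_measurable_integrable; apply: bounded_measurableD => //.
  exact: bounded_measurable_cst.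
rewrite RintegralZl //; last exact: bounded_measurable_integrable.
rewrite RintegralD //; last 2 first.
- exact/bounded_measurable_integrable/bounded_measurable_cst.
- exact: bounded_measurable_integrable.
rewrite !Rintegral_indic_probability //; last exact: measurable_le_set.
rewrite Rintegral_cst_probability [X in _ - (_ + fine X)](normal_prob_set1 t).
by rewrite /= addr0.
Qed.

Lemma centered_rank_norm t : `|centered_rank t| <= 1.
Proof.
rewrite -Rintegral_sgr_normal; apply: normr_Rintegral_le.
  by apply: (measurableT_comp (@measurable_sgr R)); exact: measurable_funB.
by move=> s; exact: normr_sgr_le1.
Qed.

Lemma measurable_centered_rank : measurable_fun [set: R] centered_rank.
Proof.
apply: measurable_funB => //; apply: measurable_funM => //.
apply: nondecreasing_measurable => // a b ab; rewrite /Phi fine_le ?fin_num_measure //.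
- exact: measurable_le_set.
- exact: measurable_le_set.
- rewrite le_measure ?inE //; [exact: measurable_le_set|exact: measurable_le_set|].
  by move=> u /= /le_trans; exact.
Qed.

(** The constant is the maximum of the standard normal density. *)
Lemma Phi_lipschitz (s t : R) : `|Phi s - Phi t| <= normal_peak 1 * `|s - t|.
Proof.
wlog st : s t / t <= s.
  by move=> h; case: (leP t s) => [|/ltW] /h //; rewrite distrC [in leRHS]distrC.
have -> : Phi s - Phi t = fine (gam `]t, s]).
  have e : [set u : R | u <= s] = [set u | u <= t] `|` `]t, s]%classic.
    apply/seteqP; split=> u /=; rewrite in_itv /=.
      by move=> us; case: (leP u t) => ut; [left|right; rewrite us].
    by case=> [/le_trans|/andP[]]; [apply|].
  rewrite /Phi e measureU //; [|exact: measurable_le_set|].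
    by rewrite fineD ?fin_num_measure //; [lra|exact: measurable_le_set].
  by apply/seteqP; split=> u //= []; rewrite in_itv /= => ut /andP[]; rewrite ltNge ut.
rewrite ger0_norm ?fine_ge0 // ger0_norm ?subr_ge0 //.
rewrite -lee_fin fineK ?fin_num_measure //.
rewrite /normal_prob.
apply: (le_trans (y := \int[lebesgue_measure]_(x in `]t, s]%classic) (normal_peak 1)%:E)%E).
  apply: ge0_le_integral => //.
  - by move=> u _; rewrite lee_fin normal_pdf_ge0.
  - by apply/measurable_EFinP/measurable_funTS; exact: measurable_normal_pdf.
  - by move=> u _; rewrite lee_fin; apply: normal_pdf_ub; rewrite oner_eq0.
rewrite integral_cst //= lebesgue_measure_itv /= lte_fin.
by case: ifP => _; rewrite ?mule0 ?lee_fin ?mulr_ge0 ?normal_peak_ge0 ?subr_ge0 // -EFinD EFinM.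
Qed.

Lemma normal_tail (eps : R) : 0 < eps ->
  exists2 N : R, 0 <= N & fine (gam [set s | N < `|s|]) <= eps.
Proof.
move=> e0.
have mtail (N : R) : measurable [set s : R | N < `|s|].
  rewrite -[X in measurable X]setTI.
  rewrite (_ : [set s : R | N < `|s|] = (@Num.norm _ R) @^-1` `]N, +oo[%classic); last first.
    by apply/seteqP; split=> s /=; rewrite in_itv /= andbT.
  by apply: normr_measurable => //; exact: measurable_itv.
have : (fun n : nat => \int[gam]_s \1_[set s : R | n%:R < `|s|] s) @ \oo --> \int[gam]_s (0 : R).
  apply: (@bounded_convergence _ _ _ gam _ _ 1) => //.
  - by move=> n; apply: measurable_indic; exact: mtail.
  - by move=> n s; rewrite indicE; case: (_ \in _) => /=; rewrite ?normr1 ?normr0.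
  - move=> s; apply: cvg_near_cst; near=> n.
    rewrite indicE memNset //=; apply/negP; rewrite -leNgt.
    by near: n; exact: nbhs_infty_ger.
rewrite Rintegral_cst_probability => /cvgr_le /(_ _ e0) /= [n _ /(_ n (leqnn n)) /=].
rewrite Rintegral_indic_probability; last exact: mtail.
by exists n%:R.
Unshelve. all: by end_near.
Qed.

End StandardNormal.

(** * Gaussian pairs and regression residuals *)

Section GaussianPair.
Context (R : realType) (d : measure_display) (T : measurableType d) (P : probability T R).
Context (p : nat) (S : 'M[R]_p) (Y : 'I_p -> T -> R).
Hypothesis mY : forall k, measurable_fun setT (Y k).
Hypothesis gY : gaussian_vector P S Y.
Hypothesis symS : S^T = S.
Hypothesis diagS : forall k, S k k = 1.

(** The vector [c] is a sum of two multiples of unit vectors, so that [k = l] is allowed; this case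
    with [b = 0] gives the law of a single coordinate. *)
Lemma gaussian_pair_law k l (a b : R) B : measurable B ->
  P ((fun w => a * Y k w + b * Y l w) @^-1` B) =
  gauss_law (a ^+ 2 + 2 * a * b * S k l + b ^+ 2) B.
Proof.
move=> mB.
pose c : 'cV[R]_p := a *: delta_mx k 0 + b *: delta_mx l 0.
have := gY c mB.
have -> : (fun w => \sum_(j < p) c j 0 * Y j w) = (fun w => a * Y k w + b * Y l w).
  apply/funext => w.
  have e i (r : R) : \sum_(j < p) (r *: delta_mx i 0 : 'cV[R]_p) j 0 * Y j w = r * Y i w.
    rewrite (bigD1 i) //= big1 ?addr0; first by rewrite !mxE !eqxx mulr1.
    by move=> j /negbTE ji; rewrite !mxE ji /= mulr0 mul0r.
  rewrite -!e -big_split; apply: eq_bigr => j _.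
  by rewrite /= -mulrDl; congr (_ * _); rewrite /c mxE.
move=> ->; congr (gauss_law _ B).
have e i j : (delta_mx 0 i : 'rV[R]_p) *m S *m delta_mx j 0 = (S i j)%:M.
  by rewrite -rowE -colE; apply/matrixP => u v; rewrite !ord1 !mxE eqxx mulr1n.
have -> : c^T = a *: delta_mx 0 k + b *: delta_mx 0 l.
  by rewrite /c linearD /= !linearZ /= !trmx_delta.
rewrite !mulmxDl !mulmxDr -!scalemxAl -!scalemxAr !e !mxE eqxx !mulr1n.
have -> : S l k = S k l by rewrite -[in LHS]symS mxE.
by rewrite !diagS; ring.
Qed.

Lemma gaussian_standard k B : measurable B -> P (Y k @^-1` B) = normal_prob 0 1 B.
Proof.
move=> mB; have := gaussian_pair_law k k 1 0 mB.
rewrite /gauss_law mulr0 mul0r expr0n /= !addr0 expr1n oner_eq0 sqrtr1 => <-.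
by congr (P _); apply/seteqP; split => w /=; rewrite mul1r mul0r addr0.
Qed.

Lemma Rintegral_sgr_gaussian k t : \int[P]_w Num.sg (t - Y k w) = centered_rank t.
Proof.
rewrite -Rintegral_sgr_normal.
apply: (@eq_law_Rintegral _ _ _ P _ _ (normal_prob 0 1) (Y k) id (fun s => Num.sg (t - s)) 1) => //.
- by apply: (measurableT_comp (@measurable_sgr R)); exact: measurable_funB.
- by move=> s; exact: normr_sgr_le1.
- exact: gaussian_standard.
Qed.


(** Since [z] is uncorrelated with [Y k], the two combinations [s Y_k + t z] and [s Y_k - t z] are
    centered Gaussian with the same variance [s^2 + t^2 (1 - S_kl^2)]. *)
Lemma gaussian_cos_flip k l s t c (z := fun w => Y l w - S k l * Y k w) :
  \int[P]_w cos (s * Y k w + t * z w + c) = \int[P]_w cos (s * Y k w - t * z w + c).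
Proof.
pose f (a b : R) w := a * Y k w + b * Y l w.
have mf a b : measurable_fun setT (f a b).
  by apply: measurable_funD => //; exact: measurable_funM.
have e1 : forall w, s * Y k w + t * z w = f (s - t * S k l) t w by move=> w; rewrite /f /z; ring.
have e2 : forall w, s * Y k w - t * z w = f (s + t * S k l) (- t) w by move=> w; rewrite /f /z;
    ring.
under eq_Rintegral do rewrite e1.
under [RHS]eq_Rintegral do rewrite e2.
apply: (@eq_law_Rintegral _ _ _ P _ _ P _ _ (fun u => cos (u + c)) 1) => //.
- apply: measurableT_comp; first exact: continuous_measurable_fun (@continuous_cos R).
  exact: measurable_funD.
- by move=> u; rewrite ler_norml cos_geN1 cos_le1.
- move=> B mB.
  rewrite (gaussian_pair_law k l _ _ mB) (gaussian_pair_law k l _ _ mB).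
  suff -> : (s - t * S k l) ^+ 2 + 2 * (s - t * S k l) * t * S k l + t ^+ 2 =
    (s + t * S k l) ^+ 2 + 2 * (s + t * S k l) * - t * S k l + (- t) ^+ 2 by [].
  ring.
Qed.

Lemma centered_rankN (k : 'I_p) (t : R) : centered_rank (- t) = - centered_rank t.
Proof.
rewrite -!(Rintegral_sgr_gaussian k) -[RHS]mulN1r -RintegralZl //; last first.
  apply: (@bounded_integrable _ _ _ _ _ 1); last by move=> w; exact: normr_sgr_le1.
  by apply: (measurableT_comp (@measurable_sgr R)); exact: measurable_funB.
have e1 w : Num.sg (- t - Y k w) = - Num.sg (Y k w + t) by rewrite -sgrN; congr Num.sg; ring.
have e2 w : -1 * Num.sg (t - Y k w) = - Num.sg (- Y k w + t) by rewrite mulN1r addrC.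
under eq_Rintegral do rewrite e1.
under [RHS]eq_Rintegral do rewrite e2.
apply: (@eq_law_Rintegral _ _ _ P _ _ P (Y k) (fun w => - Y k w) (fun u => - Num.sg (u + t)) 1)
    => //.
- exact: measurableT_comp.
- apply: measurableT_comp => //; apply: (measurableT_comp (@measurable_sgr R)).
  exact: measurable_funD.
- by move=> u; rewrite normrN normr_sgr_le1.
move=> B mB; have := gaussian_pair_law k k 1 0 mB; have := gaussian_pair_law k k (-1) 0 mB.
rewrite !mulr0 !mul0r expr0n /= !addr0 expr1n sqrrN expr1n => <- h.
transitivity (P ((fun w => 1 * Y k w + 0 * Y k w) @^-1` B)).
  by congr (P _); apply/seteqP; split => w /=; rewrite mul1r mul0r addr0.
by rewrite h; congr (P _); apply/seteqP; split => w /=; rewrite mulN1r mul0r addr0.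
Qed.

(** Replacing [z] by [- z] preserves the integral by [flip_invariant_sgr] and reverses it by oddness
    of [centered_rank]. The former concerns signs, so [centered_rank (z w)] is first written as the
    mean over [w'] of [Num.sg (z w - Y k w')]. *)
Lemma Rintegral_sgr_residual k l a (z := fun w => Y l w - S k l * Y k w) :
  \int[P]_w (Num.sg (Y k w - a) * centered_rank (z w)) = 0.
Proof.
have mz : measurable_fun setT z by apply: measurable_funB => //; exact: measurable_funM.
pose A e := \int[P]_w (Num.sg (Y k w - a) * centered_rank (e * z w)).
have AE e : A e = \int[P]_w' \int[P]_w (Num.sg (Y k w - a) * Num.sg (e * z w - Y k w')).
  rewrite -(@Fubini_probability _ _ _ P _ _ P _ 1).
  - apply: eq_Rintegral => w _; rewrite RintegralZl // ?(Rintegral_sgr_gaussian k) //.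
    apply: (@bounded_integrable _ _ _ _ _ 1); last by move=> v; exact: normr_sgr_le1.
    by apply: (measurableT_comp (@measurable_sgr R)); exact: measurable_funB.
  - apply: measurable_funM; apply: (measurableT_comp (@measurable_sgr R)).
      by apply: measurable_funB => //; exact: (measurableT_comp (mY k) measurable_fst).
    apply: measurable_funB; last exact: (measurableT_comp (mY k) measurable_snd).
    by apply: measurable_funM => //; exact: (measurableT_comp mz measurable_fst).
  - by move=> w w'; rewrite normrM mulr_ile1 // normr_sgr_le1.
have A1 : A 1 = A (-1).
  rewrite !AE; apply: eq_Rintegral => w' _.
  have := @flip_invariant_sgr R _ _ P _ _ (mY k) mz (@gaussian_cos_flip k l) a (Y k w').
  rewrite /flip_invariant => h.
  transitivity (\int[P]_w (Num.sg (Y k w - a) * Num.sg (z w - Y k w'))).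
    by apply: eq_Rintegral => w _; rewrite mul1r.
  by rewrite h; apply: eq_Rintegral => w _; rewrite mulN1r.
have AN : A (-1) = - A 1.
  have b1 : bounded_measurable (fun w => Num.sg (Y k w - a) * centered_rank (1 * z w)).
    apply: bounded_measurableM; split.
    - by apply: (measurableT_comp (@measurable_sgr R)); exact: measurable_funB.
    - by exists 1 => w; exact: normr_sgr_le1.
    - by apply: (measurableT_comp (@measurable_centered_rank R)); exact: measurable_funM.
    - by exists 1 => w; exact: centered_rank_norm.
  have Z1 := RintegralZl (-1) measurableT (bounded_measurable_integrable P b1).
  rewrite -[RHS]mulN1r /A -Z1; apply: eq_Rintegral => w _.
  by rewrite mulN1r (centered_rankN k) mul1r mulrN mulN1r.
transitivity (A 1); first by apply: eq_Rintegral => w _; rewrite mul1r.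
by move/eqP: A1; rewrite AN -addr_eq0 -mulr2n mulrn_eq0 => /eqP.
Qed.

(** Writing [centered_rank (Y k w)] as the mean of [Num.sg (Y k w - Y k w')] reduces to
    [Rintegral_sgr_residual] with [a = Y k w'], averaged over [w']. *)
Lemma Rintegral_rank_residual k l (z := fun w => Y l w - S k l * Y k w) :
  \int[P]_w (centered_rank (Y k w) * centered_rank (z w)) = 0.
Proof.
have mz : measurable_fun setT z by apply: measurable_funB => //; exact: measurable_funM.
have -> : \int[P]_w (centered_rank (Y k w) * centered_rank (z w)) =
   \int[P]_w \int[P]_w' (Num.sg (Y k w - Y k w') * centered_rank (z w)).
  apply: eq_Rintegral => w _; rewrite RintegralZr // ?(Rintegral_sgr_gaussian k) //.
  apply: (@bounded_integrable _ _ _ _ _ 1); last by move=> v; exact: normr_sgr_le1.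
  by apply: (measurableT_comp (@measurable_sgr R)); exact: measurable_funB.
rewrite (@Fubini_probability _ _ _ P _ _ P _ 1).
- rewrite -[RHS](@Rintegral_cst_probability _ _ _ P).
  by apply: eq_Rintegral => w' _; exact: Rintegral_sgr_residual.
- apply: measurable_funM.
    apply: (measurableT_comp (@measurable_sgr R)).
    by apply: measurable_funB; [exact: (measurableT_comp (mY k) measurable_fst)|exact:
        (measurableT_comp (mY k) measurable_snd)].
  apply: (measurableT_comp (@measurable_centered_rank R)).
  exact: (measurableT_comp mz measurable_fst).
- by move=> w w'; rewrite normrM mulr_ile1 ?normr_sgr_le1 // centered_rank_norm.
Qed.

(* Regressing [Y l] on [Y k] leaves a residual [z] whose sign is symmetric given
   [Y k]; only the increment from [z] to [Y l], which is [S k l * Y k],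
   contributes. *)
Lemma sgr_rank_covariance k l a (N : R) : 0 <= N ->
  `|\int[P]_w ((Num.sg (Y k w - a) - centered_rank (Y k w)) * centered_rank (Y l w))| <=
  4 * (normal_peak 1 * `|S k l| * N) + 4 * fine (normal_prob (0:R) 1 [set s | (N < `|s|)%R]).
Proof.
move=> N0; set K := normal_peak 1; set tail := fine _.
pose z w := Y l w - S k l * Y k w.
have mz : measurable_fun setT z by apply: measurable_funB => //; exact: measurable_funM.
pose f w := Num.sg (Y k w - a) - centered_rank (Y k w).
have bsg : bounded_measurable (fun w => Num.sg (Y k w - a)).
  split; last by exists 1 => w; exact: normr_sgr_le1.
  by apply: (measurableT_comp (@measurable_sgr R)); exact: measurable_funB.
have bh (y : T -> R) : measurable_fun setT y -> bounded_measurable (fun w => centered_rank (y w)).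
  move=> my; split; last by exists 1 => w; exact: centered_rank_norm.
  exact: (measurableT_comp (@measurable_centered_rank R)).
have bf : bounded_measurable f by apply: bounded_measurableB => //; exact: bh.
have f2 w : `|f w| <= 2.
  rewrite (le_trans (ler_normB _ _)) //.
  by have := normr_sgr_le1 (Y k w - a); have := centered_rank_norm (Y k w); lra.
have fz : \int[P]_w (f w * centered_rank (z w)) = 0.
  under eq_Rintegral do rewrite mulrBl.
  rewrite RintegralB ?Rintegral_sgr_residual ?Rintegral_rank_residual ?subrr //.
    by apply: bounded_measurable_integrable; apply: bounded_measurableM => //; exact: bh.
  by apply: bounded_measurable_integrable; apply: bounded_measurableM; exact: bh.
have bfh (y : T -> R) : measurable_fun setT y -> bounded_measurable (fun w => f w *
    centered_rank (y w)).
  by move=> my; apply: bounded_measurableM => //; exact: bh.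
rewrite -[\int[P]_w _]subr0 -[X in _ - X]fz -RintegralB //;
  try by apply: bounded_measurable_integrable; exact: bfh.
have bd : bounded_measurable (fun w => f w * centered_rank (Y l w) - f w * centered_rank (z w)).
  by apply: bounded_measurableB; exact: bfh.
apply: le_trans (le_normr_Rintegral _ _) _ => //; first exact: bounded_measurable_integrable.
have mtail : measurable [set w | N < `|Y k w|].
  rewrite -[X in measurable X]setTI.
  have := (measurableT_comp (@normr_measurable R setT) (mY k)) measurableT _ (measurable_itv
      `]N, +oo[).
  by rewrite (_ : _ @^-1` _ = [set w | N < `|Y k w|]) //; apply/seteqP; split=> w /=; rewrite
      in_itv /= andbT.
have -> : 4 * (K * `|S k l| * N) + 4 * tail =
    \int[P]_w (4 * (K * `|S k l| * N) + 4 * \1_[set w | N < `|Y k w|] w).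
  rewrite RintegralD //.
  - rewrite Rintegral_cst_probability RintegralZl //.
      rewrite Rintegral_indic_probability //; congr (_ + _ * fine _).
      rewrite -(gaussian_standard k) //.
      rewrite (_ : [set s : R | N < `|s|] = (@Num.norm _ R) @^-1` `]N, +oo[%classic); last first.
        by apply/seteqP; split=> s /=; rewrite in_itv /= andbT.
      by rewrite -[X in measurable X]setTI; apply: normr_measurable => //; exact: measurable_itv.
    by apply: bounded_measurable_integrable; exact: bounded_measurable_indic.
  - exact/bounded_measurable_integrable/bounded_measurable_cst.
  - apply: bounded_measurable_integrable; apply: bounded_measurableM.
      exact: bounded_measurable_cst.
    exact: bounded_measurable_indic.
apply: le_Rintegral => //.
- apply: bounded_measurable_integrable; case: bd => m1 [M bM]; split.
    exact: measurableT_comp.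
  by exists M => w; rewrite normr_id; exact: bM.
- apply: bounded_measurable_integrable; apply: bounded_measurableD.
    exact: bounded_measurable_cst.
  apply: bounded_measurableM; first exact: bounded_measurable_cst.
  exact: bounded_measurable_indic.
move=> w _; rewrite -mulrBr normrM.
have K0 : 0 <= K by exact: normal_peak_ge0.
have h1 : `|centered_rank (Y l w) - centered_rank (z w)| <= 2.
  rewrite (le_trans (ler_normB _ _)) //.
  by have := centered_rank_norm (Y l w); have := centered_rank_norm (z w); lra.
have h2 : `|centered_rank (Y l w) - centered_rank (z w)| <= 2 * (K * `|S k l| * `|Y k w|).
  rewrite /centered_rank.
  rewrite (_ : _ - _ = 2 * (Phi (Y l w) - Phi (z w))); last by ring.
  rewrite normrM ger0_norm // ler_pM2l //.
  apply: (le_trans (Phi_lipschitz _ _)).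
  by rewrite -mulrA -normrM /z opprB addrC subrK.
have f0 := normr_ge0 (f w); have := f2 w.
(* For [|Y k w| <= N] the bound is [|f w| <= 2] times [2 * K * |S k l| * N]; on the tail it is
   [2 * 2]. Hence the two factors 4. *)
rewrite indicE; case: (leP `|Y k w| N) => YN.
  rewrite memNset /=; last by apply/negP; rewrite -leNgt.
  rewrite mulr0 addr0 => fw.
  apply: (le_trans (y := 2 * (2 * (K * `|S k l| * `|Y k w|)))); first exact: ler_pM.
  rewrite mulrA -natrM ler_pM2l //; apply: ler_wpM2l => //.
  exact: mulr_ge0.
rewrite mem_set //= mulr1 => fw.
have : 0 <= K * `|S k l| * N by rewrite !mulr_ge0.
have : `|f w| * `|centered_rank (Y l w) - centered_rank (z w)| <= 2 * 2 by exact: ler_pM.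
lra.
Qed.

End GaussianPair.

(** * Second moments *)

Section SecondMoment.
Context (R : realType) (d : measure_display) (T : measurableType d) (P : probability T R).
Context (I : finType) (U : I -> T -> R).
Hypothesis bU : forall a, bounded_measurable (U a).

Lemma second_moment_le (B : I -> I -> R) :
  (forall a b, \int[P]_w (U a w * U b w) <= B a b) ->
  \int[P]_w ((\sum_a U a w) ^+ 2) <= \sum_b \sum_a B a b.
Proof.
move=> UB.
have -> : \int[P]_w ((\sum_a U a w) ^+ 2) = \sum_b \sum_a \int[P]_w (U a w * U b w).
  transitivity (\int[P]_w (\sum_b \sum_a U a w * U b w)).
    apply: eq_Rintegral => w _; rewrite expr2 mulr_sumr; apply: eq_bigr => b _.
    by rewrite mulr_suml.
  rewrite Rintegral_sum => [|b _]; last first.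
    by apply: bounded_measurable_sum => a _; exact: bounded_measurableM.
  apply: eq_bigr => b _; rewrite Rintegral_sum // => a _.
  exact: bounded_measurableM.
by apply: ler_sum => b _; apply: ler_sum => a _.
Qed.

End SecondMoment.

Section Projections.
Context (R : realType) (d : measure_display) (T : measurableType d) (P : probability T R).
Context (n p : nat) (X : 'I_n -> 'I_p -> T -> R).
Hypothesis mX : forall i k, measurable_fun setT (X i k).
Hypothesis indX : indep_vectors P X.
Hypothesis rankX : forall i k t, \int[P]_w Num.sg (t - X i k w) = centered_rank t.
Local Notation Tsub S := (g_sigma_algebraType (sample_rectangles X S)).

(** This is [u_ijk]; for [j] different from [i], [rankX] gives it mean zero in [X j] when [X i] is
    frozen. *)
Definition deviation k i j w : R := Num.sg (X i k w - X j k w) - centered_rank (X i k w).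

Lemma normr_deviation k i j w : `|deviation k i j w| <= 2.
Proof.
apply: (le_trans (ler_normB _ _)).
exact: (lerD (normr_sgr_le1 _) (centered_rank_norm _)).
Qed.

Lemma measurable_rank_sub (S : {pred 'I_n}) i k : i \in S ->
  measurable_fun setT ((fun w => centered_rank (X i k w)) : Tsub S -> R).
Proof.
by move=> iS; apply: (measurableT_comp (@measurable_centered_rank R)); exact: measurable_sample.
Qed.

Lemma measurable_deviation_sub (S : {pred 'I_n}) k i j : i \in S -> j \in S ->
  measurable_fun setT (deviation k i j : Tsub S -> R).
Proof.
move=> iS jS; apply: measurable_funB; last exact: measurable_rank_sub.
by apply: (measurableT_comp (@measurable_sgr R)); apply: measurable_funB; exact: measurable_sample.
Qed.

Lemma measurable_sub_sample (S : {pred 'I_n}) (f : T -> R) :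
  measurable_fun setT (f : Tsub S -> R) -> measurable_fun setT f.
Proof.
move=> mf _ B mB; have := mf measurableT B mB; apply: smallest_sub => //.
  exact: sigma_algebra_measurable.
exact: measurable_sample_rectangles.
Qed.

Lemma bounded_rank i k : bounded_measurable (fun w => centered_rank (X i k w)).
Proof.
split; last by exists 1 => w; exact: centered_rank_norm.
by apply: (@measurable_sub_sample predT); exact: measurable_rank_sub.
Qed.

(* Integrating out [X j] kills [deviation k i j]. *)
Lemma deviation_orthogonal k i j (Z : T -> R) M : i != j ->
  measurable_fun setT (Z : Tsub (predC1 j) -> R) -> (forall w, `|Z w| <= M) ->
  \int[P]_w (deviation k i j w * Z w) = 0.
Proof.
move=> ij mZ bZ.
pose f (a b : T) := (Num.sg (X i k b - X j k a) - centered_rank (X i k b)) * Z b.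
have iS : i \in predC1 j by [].
have jS : j \in pred1 j by rewrite inE.
apply/eqP; rewrite -normr_le0.
apply: (@decoupling_bound _ _ _ P _ _ X mX indX (pred1 j) (predC1 j) f (2 * M)).
- by move=> r; rewrite !inE => /eqP ->; rewrite eqxx.
- apply: measurable_funM; last exact: (measurableT_comp mZ measurable_snd).
  apply: measurable_funB; last exact: (measurableT_comp (measurable_rank_sub k iS) measurable_snd).
  apply: (measurableT_comp (@measurable_sgr R)); apply: measurable_funB.
    exact: (measurableT_comp (measurable_sample (X := X) k iS) measurable_snd).
  exact: (measurableT_comp (measurable_sample (X := X) k jS) measurable_fst).
- move=> a b; rewrite normrM ler_pM //; apply: (le_trans (ler_normB _ _)).
  exact: (lerD (normr_sgr_le1 _) (centered_rank_norm _)).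
- move=> b; rewrite normr_le0; apply/eqP.
  have bs : bounded_measurable (fun a => Num.sg (X i k b - X j k a)).
    split; last by exists 1 => a; exact: normr_sgr_le1.
    by apply: (measurableT_comp (@measurable_sgr R)); exact: measurable_funB.
  rewrite RintegralZr //; last first.
    apply: bounded_measurable_integrable; apply: bounded_measurableB => //.
    exact: bounded_measurable_cst.
  rewrite RintegralB //; last 2 first.
  + exact: bounded_measurable_integrable.
  + exact/bounded_measurable_integrable/bounded_measurable_cst.
  by rewrite rankX Rintegral_cst_probability subrr mul0r.
Qed.

Variables (k l : 'I_p) (c0 : R).
Hypothesis cov_le : forall i a,
  `|\int[P]_w ((Num.sg (X i k w - a) - centered_rank (X i k w)) * centered_rank (X i l w))| <= c0.

(** Everything but [X i] is frozen: [X j k] becomes a constant [a], [Z] a constant of size at most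
    [M], and the remaining integral over [X i] is the one in [cov_le]. *)
Lemma shared_index_le i j (Z : T -> R) M : i != j ->
  measurable_fun setT (Z : Tsub (predC1 i) -> R) -> (forall w, `|Z w| <= M) ->
  `|\int[P]_w (deviation k i j w * centered_rank (X i l w) * Z w)| <= c0 * M.
Proof.
move=> ij mZ bZ.
pose f (a b : T) := (Num.sg (X i k a - X j k b) - centered_rank (X i k a)) * centered_rank (X i
    l a) * Z b.
have iS : i \in pred1 i by rewrite inE.
have jS : j \in predC1 i by rewrite inE eq_sym.
have fn a t : `|(Num.sg (X i k a - t) - centered_rank (X i k a)) * centered_rank (X i l a)| <= 2.
  rewrite normrM -[leRHS]mulr1; apply: ler_pM => //; last exact: centered_rank_norm.
  apply: (le_trans (ler_normB _ _)).
  exact: (lerD (normr_sgr_le1 _) (centered_rank_norm _)).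
apply: (@decoupling_bound _ _ _ P _ _ X mX indX (pred1 i) (predC1 i) f (2 * M)).
- by move=> r; rewrite !inE => /eqP ->; rewrite eqxx.
- apply: measurable_funM; last exact: (measurableT_comp mZ measurable_snd).
  apply: measurable_funM; last exact: (measurableT_comp (measurable_rank_sub l iS) measurable_fst).
  apply: measurable_funB; last exact: (measurableT_comp (measurable_rank_sub k iS) measurable_fst).
  apply: (measurableT_comp (@measurable_sgr R)); apply: measurable_funB.
    exact: (measurableT_comp (measurable_sample (X := X) k iS) measurable_fst).
  exact: (measurableT_comp (measurable_sample (X := X) k jS) measurable_snd).
- by move=> a b; rewrite normrM ler_pM.
- move=> b; rewrite RintegralZr //; last first.
    apply: (@bounded_integrable _ _ _ _ _ 2) => //.
    apply: measurable_funM; last exact: (bounded_rank _ _).1.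
    apply: measurable_funB; last exact: (bounded_rank _ _).1.
    by apply: (measurableT_comp (@measurable_sgr R)); exact: measurable_funB.
  by rewrite normrM ler_pM.
Qed.

End Projections.

Section Moments.
Context (R : realType) (d : measure_display) (T : measurableType d) (P : probability T R).
Context (n p : nat) (X : 'I_n -> 'I_p -> T -> R).
Hypothesis mX : forall i k, measurable_fun setT (X i k).
Hypothesis indX : indep_vectors P X.
Hypothesis rankX : forall i k t, \int[P]_w Num.sg (t - X i k w) = centered_rank t.
Local Notation Tsub S := (g_sigma_algebraType (sample_rectangles X S)).
Local Notation deviation := (deviation X).

(** The term [u_ijk a_il] at the pair [(i, j)], set to 0 on the diagonal so that sums run over all
    pairs. *)
Definition rank_cross k l (a : 'I_n * 'I_n) w : R :=
  if a.1 == a.2 then 0 else deviation k a.1 a.2 w * centered_rank (X a.1 l w).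

Lemma normr_rank_cross k l a w : `|rank_cross k l a w| <= 2.
Proof.
rewrite /rank_cross; case: ifP => _; first by rewrite normr0.
rewrite normrM -[leRHS]mulr1; apply: ler_pM => //; first exact: normr_deviation.
exact: centered_rank_norm.
Qed.

Lemma measurable_rank_cross_sub (S : {pred 'I_n}) k l a : a.1 \in S -> a.2 \in S ->
  measurable_fun setT (rank_cross k l a : Tsub S -> R).
Proof.
move=> iS jS; rewrite /rank_cross; case: (a.1 == a.2); first exact: measurable_cst.
apply: measurable_funM; first exact: measurable_deviation_sub.
exact: measurable_rank_sub.
Qed.

Lemma bounded_rank_cross k l a : bounded_measurable (rank_cross k l a).
Proof.
split; last by exists 2 => w; exact: normr_rank_cross.
by apply: (measurable_sub_sample mX (S := predT)); exact: measurable_rank_cross_sub.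
Qed.

Lemma normr_Rintegral_rank_cross k l a b :
  `|\int[P]_w (rank_cross k l a w * rank_cross k l b w)| <= 4.
Proof.
apply: normr_Rintegral_le => [|w].
  by apply: measurable_funM; exact: (bounded_rank_cross _ _ _).1.
rewrite normrM; apply: (le_trans (ler_pM _ _ (normr_rank_cross k l a w) (normr_rank_cross k l b
    w))) => //.
by rewrite -natrM.
Qed.

Lemma rank_cross_orthogonal k l a b : a.2 != b.1 -> a.2 != b.2 ->
  \int[P]_w (rank_cross k l a w * rank_cross k l b w) = 0.
Proof.
move=> ab1 ab2; have [a12|a12] := eqVneq a.1 a.2.
  rewrite -[RHS](@Rintegral_cst_probability _ _ _ P).
  by apply: eq_Rintegral => w _; rewrite /rank_cross a12 eqxx mul0r.
rewrite -[RHS](@deviation_orthogonal _ _ _ P _ _ X mX indX rankX k a.1 a.2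
  (fun w => centered_rank (X a.1 l w) * rank_cross k l b w) (1 * 2)) //.
- by apply: eq_Rintegral => w _; rewrite {1}/rank_cross (negbTE a12) mulrA.
- apply: measurable_funM; first exact: measurable_rank_sub.
  by apply: measurable_rank_cross_sub; rewrite !inE eq_sym.
- move=> w; rewrite normrM; apply: ler_pM => //; first exact: centered_rank_norm.
  exact: normr_rank_cross.
Qed.

Lemma rank_cross_second_moment k l (c0 : R) :
  0 <= c0 ->
  (forall i a, `|\int[P]_w ((Num.sg (X i k w - a) - centered_rank (X i k w)) *
     centered_rank (X i l w))| <= c0) ->
  \int[P]_w ((\sum_a rank_cross k l a w) ^+ 2) <= 8 * n%:R ^+ 2 + 2 * c0 * n%:R ^+ 3.
Proof.
move=> c00 cov_le.
(* The crude bound [4 = 2 * 2] is kept for [b] equal to [a] or to its reversal; [2 * c0] is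
   [shared_index_le] with [M = 2], for pairs with the same second index. For fixed [a] the sum over
   [b] is [8 + 2 * c0 * n]. *)
pose B (a b : 'I_n * 'I_n) : R :=
  4 * (b == (a.2, a.1))%:R + 4 * (b == a)%:R + 2 * c0 * (b.2 == a.2)%:R.
apply: (le_trans (second_moment_le (bounded_rank_cross k l) (B := B) _)); last first.
  have n2 : \sum_(b : 'I_n * 'I_n) (1 : R) = n%:R ^+ 2.
    by rewrite sumr_const card_prod card_ord natrM expr2.
  rewrite exchange_big /=.
  have e1 (a : 'I_n * 'I_n) : \sum_b (b == a)%:R = 1 :> R.
    rewrite (bigD1 a) //= eqxx big1 ?addr0 // => b /negbTE -> //.
  have e2 (j : 'I_n) : \sum_(b : 'I_n * 'I_n) (b.2 == j)%:R = n%:R :> R.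
    rewrite -(pair_bigA _ (fun i j' => (j' == j)%:R : R)) /=.
    rewrite -[in RHS](card_ord n) -sumr_const; apply: eq_bigr => i _.
    by rewrite (bigD1 j) //= eqxx big1 ?addr0 // => b /negbTE ->.
  have -> : \sum_a \sum_b B a b = \sum_(a : 'I_n * 'I_n) (8 + 2 * c0 * n%:R).
    apply: eq_bigr => a _; rewrite !big_split /= -!mulr_sumr !e1 e2 !mulr1.
    by congr (_ + _); rewrite -natrD.
  have -> : \sum_(a : 'I_n * 'I_n) (8 + 2 * c0 * n%:R) = (8 + 2 * c0 * n%:R) * n%:R ^+ 2.
    by rewrite -n2 mulr_sumr; apply: eq_bigr => a _; rewrite mulr1.
  by rewrite le_eqVlt; apply/orP; left; apply/eqP; ring.
move=> a b; rewrite /B.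
have b4 := normr_Rintegral_rank_cross k l a b; move: b4; rewrite ler_norml => /andP[_ b4].
have p1 : 0 <= 4 * (b == (a.2, a.1))%:R :> R by rewrite mulr_ge0.
have p2 : 0 <= 4 * (b == a)%:R :> R by rewrite mulr_ge0.
have p3 : 0 <= 2 * c0 * (b.2 == a.2)%:R by rewrite !mulr_ge0.
have [ab2|ab2] := eqVneq b.2 a.2.
  have [ab1|ab1] := eqVneq b.1 a.1.
    have -> : (b == a) by rewrite -pair_eqE /= ab1 ab2 !eqxx.
    rewrite mulr1; apply: (le_trans b4).
    by rewrite -addrA addrCA lerDl addr_ge0 // !mulr_ge0.
  have [a12|a12] := eqVneq a.1 a.2.
    have -> : \int[P]_w (rank_cross k l a w * rank_cross k l b w) = 0.
      rewrite -[RHS](@Rintegral_cst_probability _ _ _ P).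
      by apply: eq_Rintegral => w _; rewrite /rank_cross a12 eqxx mul0r.
    by rewrite !addr_ge0 // !mulr_ge0.
  apply: (@le_trans _ _ (2 * c0)); last first.
    by rewrite mulr1 lerDr addr_ge0.
  have := @shared_index_le _ _ _ P _ _ X mX indX k l c0 cov_le a.1 a.2
    (rank_cross k l b) 2 a12 _ (normr_rank_cross k l b).
  rewrite ler_norml => /(_ _)/andP[|_ h].
    by apply: measurable_rank_cross_sub; rewrite !inE // ab2 eq_sym.
  rewrite mulrC; apply: le_trans h; rewrite le_eqVlt; apply/orP; left; apply/eqP.
  by apply: eq_Rintegral => w _; rewrite {1}/rank_cross (negbTE a12).
(* The second indices now differ. If [a.2] does not occur in [b], it is integrated out; otherwise
   [a.2 = b.1], and [b.2] can be integrated out unless it equals [a.1], which makes [b] the reversal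
   of [a]. *)
have [ab1|ab1] := eqVneq a.2 b.1; last first.
  by rewrite (rank_cross_orthogonal _ _ ab1) 1?eq_sym // !addr_ge0 // !mulr_ge0.
have [ba1|ba1] := eqVneq b.2 a.1.
  have -> : (b == (a.2, a.1)) by rewrite -pair_eqE /= ab1 ba1 !eqxx.
  by rewrite mulr1; apply: (le_trans b4); rewrite -addrA lerDl addr_ge0 // !mulr_ge0.
have -> : \int[P]_w (rank_cross k l a w * rank_cross k l b w) = 0.
  rewrite -(rank_cross_orthogonal k l ba1 ab2).
  by apply: eq_Rintegral => w _; exact: mulrC.
by rewrite !addr_ge0 // !mulr_ge0.
Qed.

Definition double_deviation k l (t : 'I_n * 'I_n * 'I_n) w : R :=
  if (t.1.1 != t.1.2) && (t.1.1 != t.2) && (t.1.2 != t.2)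
  then deviation k t.1.1 t.1.2 w * deviation l t.1.1 t.2 w else 0.

Lemma normr_double_deviation k l t w : `|double_deviation k l t w| <= 4.
Proof.
rewrite /double_deviation; case: ifP => _; last by rewrite normr0.
have -> : 4 = 2 * 2 :> R by rewrite -natrM.
by rewrite normrM; apply: ler_pM => //; exact: normr_deviation.
Qed.

Lemma measurable_double_deviation_sub (S : {pred 'I_n}) k l t :
  t.1.1 \in S -> t.1.2 \in S -> t.2 \in S ->
  measurable_fun setT (double_deviation k l t : Tsub S -> R).
Proof.
move=> iS jS mS; rewrite /double_deviation; case: (_ && _); last exact: measurable_cst.
by apply: measurable_funM; exact: measurable_deviation_sub.
Qed.

Lemma bounded_double_deviation k l t : bounded_measurable (double_deviation k l t).
Proof.
split; last by exists 4 => w; exact: normr_double_deviation.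
by apply: (measurable_sub_sample mX (S := predT)); exact: measurable_double_deviation_sub.
Qed.

Definition indices (t : 'I_n * 'I_n * 'I_n) : seq 'I_n := [:: t.1.1; t.1.2; t.2].

(** The index that does not occur in [t] is integrated out by [deviation_orthogonal]. When the
    entries of [s] are distinct, it does not occur in the other deviation of [s] either; otherwise
    the term is 0. *)
Lemma double_deviation_orthogonal k l s t :
  (s.1.2 \notin indices t) || (s.2 \notin indices t) ->
  \int[P]_w (double_deviation k l s w * double_deviation k l t w) = 0.
Proof.
move=> st; have [ds|ds] := boolP ((s.1.1 != s.1.2) && (s.1.1 != s.2) && (s.1.2 != s.2)); last first.
  rewrite -[RHS](@Rintegral_cst_probability _ _ _ P).
  by apply: eq_Rintegral => w _; rewrite /double_deviation (negbTE ds) mul0r.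
have /andP[/andP[s1 s2] s3] := ds.
have bZ k' i j w : `|deviation k' i j w * double_deviation k l t w| <= 2 * 4.
  by rewrite normrM; apply: ler_pM => //; [exact: normr_deviation|exact: normr_double_deviation].
case/orP: st; rewrite !inE !negb_or => /and3P[t1 t2 t3].
  rewrite -[RHS](@deviation_orthogonal _ _ _ P _ _ X mX indX rankX k s.1.1 s.1.2
    (fun w => deviation l s.1.1 s.2 w * double_deviation k l t w) (2 * 4)) //.
    by apply: eq_Rintegral => w _; rewrite {1}/double_deviation ds mulrA.
  apply: measurable_funM; first by apply: measurable_deviation_sub => //; rewrite !inE eq_sym.
  by apply: measurable_double_deviation_sub; rewrite !inE eq_sym.
rewrite -[RHS](@deviation_orthogonal _ _ _ P _ _ X mX indX rankX l s.1.1 s.2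
  (fun w => deviation k s.1.1 s.1.2 w * double_deviation k l t w) (2 * 4)) //.
  by apply: eq_Rintegral => w _; rewrite {1}/double_deviation ds mulrCA mulrA.
apply: measurable_funM; first by apply: measurable_deviation_sub.
by apply: measurable_double_deviation_sub; rewrite !inE eq_sym.
Qed.

(** A pair contributes only if [s.1.2] and [s.2] both occur in [t]. This leaves at most [3 * 3]
    choices for them, [n] for [s.1.1] and [n ^ 3] for [t]; with [16 = 4 * 4] per pair the total is
    [144 * n ^ 4]. In the proof [N t j] counts the occurrences of [j] in [t]. *)
Lemma double_deviation_second_moment k l :
  \int[P]_w ((\sum_t double_deviation k l t w) ^+ 2) <= 144 * n%:R ^+ 4.
Proof.
pose N (t : 'I_n * 'I_n * 'I_n) (j : 'I_n) : R := \sum_(r <- indices t) (j == r)%:R.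
pose B (s t : 'I_n * 'I_n * 'I_n) : R := 16 * (N t s.1.2 * N t s.2).
have N0 t j : 0 <= N t j by apply: sumr_ge0.
have N1 t j : j \in indices t -> 1 <= N t j.
  rewrite /N /indices !big_cons big_nil !inE => /or3P[] /eqP ->;
  rewrite eqxx; do !case: (_ == _) => /=; lra.
apply: (le_trans (second_moment_le (bounded_double_deviation k l) (B := B) _)); last first.
  have sN t : \sum_j N t j = 3.
    have e1 (r : 'I_n) : \sum_j (j == r)%:R = 1 :> R.
      by rewrite (bigD1 r) //= eqxx big1 ?addr0 // => b /negbTE ->.
    rewrite exchange_big /= /indices !big_cons big_nil !e1; lra.
  have sB t : \sum_s B s t = 144 * n%:R.
    rewrite -mulr_sumr -(pair_bigA _ (fun u m => N t u.2 * N t m)) /=.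
    rewrite (eq_bigr (fun u : 'I_n * 'I_n => N t u.2 * 3)); last first.
      by move=> u _; rewrite -mulr_sumr sN.
    rewrite -mulr_suml -(pair_bigA _ (fun i j => N t j)) /=.
    rewrite (eq_bigr (fun=> 3)); last by move=> i _; exact: sN.
    by rewrite sumr_const card_ord -[3 *+ n]mulr_natr; ring.
  rewrite (eq_bigr (fun=> 144 * n%:R)); last by move=> t _; exact: sB.
  rewrite sumr_const !card_prod card_ord -[leLHS]mulr_natr !natrM le_eqVlt; apply/orP; left;
      apply/eqP; ring.
move=> s t; rewrite /B.
have [st|st] := boolP ((s.1.2 \notin indices t) || (s.2 \notin indices t)).
  by rewrite double_deviation_orthogonal // !mulr_ge0.
move: st; rewrite negb_or !negbK => /andP[/N1 h1 /N1 h2].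
apply: (@le_trans _ _ 16); last first.
  by rewrite -[leLHS]mulr1 ler_pM2l // mulr_ege1.
apply: (le_trans (ler_norm _)); apply: normr_Rintegral_le => [|w].
  by apply: measurable_funM; exact: (bounded_double_deviation _ _ _).1.
have -> : 16 = 4 * 4 :> R by rewrite -natrM.
by rewrite normrM; apply: ler_pM => //; exact: normr_double_deviation.
Qed.

End Moments.

(** * Sums over distinct triples and numerical constants *)

Section DistinctSums.
Context (R : realType) (n : nat).

Lemma sum_distinct_pair (F : 'I_n -> 'I_n -> R) :
  \sum_i \sum_j \sum_(m < n | (i != j) && (i != m) && (j != m)) F i j =
  (n%:R - 2) * \sum_i \sum_j (if i == j then 0 else F i j).
Proof.
rewrite mulr_sumr; apply: eq_bigr => i _; rewrite mulr_sumr; apply: eq_bigr => j _.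
have [ij|ij] := eqVneq i j; first by rewrite big_pred0 ?mulr0.
have -> : n%:R - 2 = \sum_(m < n | (i != m) && (j != m)) (1 : R).
  have : \sum_(m < n) (1 : R) = n%:R by rewrite sumr_const card_ord.
  rewrite (bigD1 i) //= (bigD1 j) 1?eq_sym //= => <-.
  rewrite [in RHS](eq_bigl (fun m => (m != i) && (m != j))); last first.
    by move=> m; rewrite ![_ == m]eq_sym.
  by move: (\sum_(_ < _ | _) _) => s; ring.
by rewrite mulr_suml; apply: eq_bigr => m _; rewrite mul1r.
Qed.

Lemma sum_distinct_single (G : 'I_n -> R) :
  \sum_i \sum_j \sum_(m < n | (i != j) && (i != m) && (j != m)) G i =
  (n%:R - 2) * (n%:R - 1) * \sum_i G i.
Proof.
rewrite (sum_distinct_pair (fun i _ => G i)) -mulrA; congr (_ * _).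
rewrite mulr_sumr; apply: eq_bigr => i _.
have : \sum_(j < n) G i = n%:R * G i by rewrite sumr_const card_ord mulr_natl.
rewrite (bigD1 i) //= => h; rewrite (bigD1 i) //= eqxx add0r mulrBl -h mul1r [G i + _]addrC addrK.
by apply: eq_bigr => j; rewrite eq_sym => /negbTE ->.
Qed.

Lemma sum_distinct_swap (F : 'I_n -> 'I_n -> 'I_n -> R) :
  \sum_i \sum_j \sum_(m < n | (i != j) && (i != m) && (j != m)) F i j m =
  \sum_i \sum_j \sum_(m < n | (i != j) && (i != m) && (j != m)) F i m j.
Proof.
apply: eq_bigr => i _.
under eq_bigr do rewrite big_mkcond.
rewrite exchange_big /=; apply: eq_bigr => m _.
rewrite [RHS]big_mkcond; apply: eq_bigr => j _.
by rewrite (eq_sym j m) [(i != j) && _]andbC.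
Qed.

Lemma sum_distinctD (F G : 'I_n -> 'I_n -> 'I_n -> R) :
  \sum_i \sum_j \sum_(m < n | (i != j) && (i != m) && (j != m)) (F i j m + G i j m) =
  \sum_i \sum_j \sum_(m < n | (i != j) && (i != m) && (j != m)) F i j m +
  \sum_i \sum_j \sum_(m < n | (i != j) && (i != m) && (j != m)) G i j m.
Proof.
rewrite -big_split; apply: eq_bigr => i _; rewrite -big_split; apply: eq_bigr => j _.
by rewrite -big_split.
Qed.

End DistinctSums.

Lemma sqr_sum3_le (R : realType) (a b s1 s2 s3 : R) :
  (a * s1 + a * s2 + b * s3) ^+ 2 <=
  3 * a ^+ 2 * s1 ^+ 2 + 3 * a ^+ 2 * s2 ^+ 2 + 3 * b ^+ 2 * s3 ^+ 2.
Proof.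
rewrite -subr_ge0.
rewrite [leRHS](_ : _ = (a * s1 - a * s2) ^+ 2 + (a * s1 - b * s3) ^+ 2 + (a * s2 - b * s3) ^+ 2).
  by rewrite !addr_ge0 // sqr_ge0.
by ring.
Qed.

(** Multiplied by [N ^+ 3] and [N ^+ 2] respectively, the two quantities decrease in [N], with
    values [27 / 2] and [9 / 2] at [N = 3]; 14 and 5 are the next integers. *)
Lemma normalization_le (R : realType) (N : R) : 3 <= N ->
  0 <= 3 / (N * (N - 1) * (N - 2)) <= 14 / N ^+ 3 /\
  0 <= 3 / (N * (N - 1) * (N - 2)) * (N - 2) <= 5 / N ^+ 2.
Proof.
move=> N3.
have N0 : 0 < N by lra.
have N1 : 0 < N - 1 by lra.
have N2 : 0 < N - 2 by lra.
have -> : 3 / (N * (N - 1) * (N - 2)) * (N - 2) = 3 / (N * (N - 1)).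
  by field; rewrite !gt_eqF.
split; apply/andP; split.
- by rewrite divr_ge0 // !mulr_ge0 // ltW.
- rewrite ler_pdivrMr; last by rewrite !mulr_gt0.
  rewrite mulrAC ler_pdivlMr ?exprn_gt0 // -subr_ge0.
  rewrite (_ : _ - _ = N * ((N - 3) * (11 * N - 9) + 1)); last by ring.
  by rewrite mulr_ge0 ?addr_ge0 ?mulr_ge0 //; lra.
- by rewrite divr_ge0 // !mulr_ge0 // ltW.
- rewrite ler_pdivrMr; last by rewrite !mulr_gt0.
  rewrite mulrAC ler_pdivlMr ?exprn_gt0 // -subr_ge0.
  rewrite (_ : _ - _ = N * (2 * N - 5)); last by ring.
  by rewrite mulr_ge0 //; lra.
Qed.

(* [1200 = 2 * 75 * 8] and [300 = 2 * 75 * 2] come from the two sums of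
   [rank_cross], [588 * 144] from the sum of [double_deviation]. *)
Definition moment_constant (R : realType) : R := 1200 + 588 * 144 + 300.

Lemma moment_constant_ge0 (R : realType) : 0 <= moment_constant R.
Proof.
apply: addr_ge0; last exact: ler0n.
by apply: addr_ge0; [exact: ler0n|apply: mulr_ge0; exact: ler0n].
Qed.

Lemma add_le_mul_add (R : realType) (a b u v : R) :
  0 <= a -> 0 <= b -> 0 <= u -> 0 <= v -> a * u + b * v <= (a + b) * (v + u).
Proof.
move=> a0 b0 u0 v0.
rewrite (_ : (a + b) * (v + u) = a * u + b * v + (a * v + b * u)); last by ring.
by rewrite lerDl addr_ge0 // mulr_ge0.
Qed.

Lemma second_moment_numeric (R : realType) (N c0 c al I1 I2 I3 : R) :
  3 <= N -> 0 <= c0 -> 0 <= c -> c <= 14 / N ^+ 3 -> 0 <= al -> al <= 5 / N ^+ 2 ->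
  0 <= I1 -> I1 <= 8 * N ^+ 2 + 2 * c0 * N ^+ 3 ->
  0 <= I2 -> I2 <= 8 * N ^+ 2 + 2 * c0 * N ^+ 3 -> 0 <= I3 -> I3 <= 144 * N ^+ 4 ->
  3 * al ^+ 2 * I1 + 3 * al ^+ 2 * I2 + 3 * c ^+ 2 * I3 <=
  moment_constant R * (c0 / N + N^-2).
Proof.
move=> N3 c00 c_ge0 c_le al_ge0 al_le i1 h1 i2 h2 i3 h3.
have N0 : 0 < N by lra.
have N0' : N != 0 by rewrite gt_eqF.
have al2 : 3 * al ^+ 2 <= 75 / N ^+ 4.
  have -> : 75 / N ^+ 4 = 3 * (5 / N ^+ 2) ^+ 2 by field.
  by rewrite ler_pM2l // lerXn2r // nnegrE // (le_trans al_ge0).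
have c2 : 3 * c ^+ 2 <= 588 / N ^+ 6.
  have -> : 588 / N ^+ 6 = 3 * (14 / N ^+ 3) ^+ 2 by field.
  by rewrite ler_pM2l // lerXn2r // nnegrE // (le_trans c_ge0).
apply: (@le_trans _ _ (75 / N ^+ 4 * (8 * N ^+ 2 + 2 * c0 * N ^+ 3) +
   75 / N ^+ 4 * (8 * N ^+ 2 + 2 * c0 * N ^+ 3) + 588 / N ^+ 6 * (144 * N ^+ 4))).
  by apply: lerD; first apply: lerD; apply: ler_pM => //; apply: mulr_ge0 => //; exact: sqr_ge0.
have -> : 75 / N ^+ 4 * (8 * N ^+ 2 + 2 * c0 * N ^+ 3) +
   75 / N ^+ 4 * (8 * N ^+ 2 + 2 * c0 * N ^+ 3) + 588 / N ^+ 6 * (144 * N ^+ 4) =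
   (1200 + 588 * 144) * N^-2 + 300 * (c0 / N) by field.
have a0 : 0 <= 1200 + 588 * 144 :> R.
  by apply: addr_ge0; [exact: ler0n|apply: mulr_ge0; exact: ler0n].
have b0 : 0 <= 300 :> R by rewrite ler0n.
rewrite /moment_constant; move: (1200 + _) 300 a0 b0 => a b a0 b0.
have u0 : 0 <= N^-2 by rewrite invr_ge0 exprn_ge0 // ltW.
have v0 : 0 <= c0 / N by rewrite divr_ge0 // ltW.
exact: add_le_mul_add.
Qed.

(** * Second moment of an entry *)

Section Entry.
Context (R : realType) (d : measure_display) (T : measurableType d) (P : probability T R).
Context (n p : nat) (X : 'I_n -> 'I_p -> T -> R).
Hypothesis n3 : (3 <= n)%N.
Local Notation c := (3 / (n%:R * (n%:R - 1) * (n%:R - 2)) : R).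

Lemma rho_tildeE k l w : rho_tilde X w k l =
  c * \sum_i \sum_j \sum_(m < n | (i != j) && (i != m) && (j != m))
    Num.sg (X i k w - X j k w) * Num.sg (X i l w - X m l w).
Proof.
rewrite /rho_tilde mxE summxE; congr (_ * _); apply: eq_bigr => i _.
rewrite summxE; apply: eq_bigr => j _; rewrite summxE; apply: eq_bigr => m _.
by rewrite !mxE big_ord1 !mxE.
Qed.

Lemma WmatE k l w : Wmat X w k l =
  3 / n%:R * \sum_i centered_rank (X i k w) * centered_rank (X i l w).
Proof.
rewrite /Wmat mxE summxE; congr (_ * _); apply: eq_bigr => i _.
by rewrite !mxE big_ord1 !mxE.
Qed.

Let n1_neq0 : n%:R - 1 != 0 :> R.
Proof. by rewrite subr_eq0 pnatr_eq1; case: n n3 => [|[|]]. Qed.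
Let n2_neq0 : n%:R - 2 != 0 :> R.
Proof. by rewrite subr_eq0 eqr_nat; case: n n3 => [|[|[|]]]. Qed.
Let n0_neq0 : n%:R != 0 :> R.
Proof. by rewrite pnatr_eq0; case: n n3. Qed.

(* Hoeffding decomposition: with [sg (x_i - x_j) = a_i + u_ij], the product
   kernel of [rho_tilde] minus that of [Wmat] is a sum of terms with at least
   one factor [u]. *)
Lemma entry_decomposition k l w : (rho_tilde X w - Wmat X w) k l =
  c * ((n%:R - 2) * \sum_a rank_cross X k l a w +
       (n%:R - 2) * \sum_a rank_cross X l k a w +
       \sum_t double_deviation X k l t w).
Proof.
rewrite mxE [X in _ + X]mxE rho_tildeE WmatE.
pose a i := centered_rank (X i k w); pose b i := centered_rank (X i l w).
(* Each [i] is the first entry of [(n - 1) * (n - 2)] distinct triples, so [Wmat] becomes a triple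
   sum with the factor of [rho_tilde] and the difference can be taken term by term. *)
have -> : 3 / n%:R * \sum_i centered_rank (X i k w) * centered_rank (X i l w) =
    c * \sum_i \sum_j \sum_(m < n | (i != j) && (i != m) && (j != m)) (a i * b i).
  rewrite (sum_distinct_single (fun i => a i * b i)) /a /b.
  by move: (\sum_i _) => s; field; rewrite n0_neq0 n1_neq0 n2_neq0.
rewrite -mulrBr; congr (_ * _).
have -> : \sum_i \sum_j \sum_(m < n | (i != j) && (i != m) && (j != m))
    Num.sg (X i k w - X j k w) * Num.sg (X i l w - X m l w) =
  \sum_i \sum_j \sum_(m < n | (i != j) && (i != m) && (j != m))
    (deviation X k i j w * b i + deviation X l i m w * a i +
     deviation X k i j w * deviation X l i m w + a i * b i).
  apply: eq_bigr => i _; apply: eq_bigr => j _; apply: eq_bigr => m _.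
  by rewrite /deviation -/(a i) -/(b i); ring.
rewrite !sum_distinctD addrK; congr (_ + _ + _).
- rewrite (sum_distinct_pair (fun i j => deviation X k i j w * b i)).
  by rewrite (pair_bigA _ (fun i j => if i == j then 0 else deviation X k i j w * b i)).
- rewrite sum_distinct_swap (sum_distinct_pair (fun i j => deviation X l i j w * a i)).
  by rewrite (pair_bigA _ (fun i j => if i == j then 0 else deviation X l i j w * a i)).
- rewrite (pair_bigA _ (fun i j => \sum_(m < n | (i != j) && (i != m) && (j != m))
    deviation X k i j w * deviation X l i m w)) /=.
  rewrite -(pair_bigA _ (fun u m => double_deviation X k l (u, m) w)) /=.
  by apply: eq_bigr => u _; rewrite big_mkcond.
Qed.

Hypothesis mX : forall i k, measurable_fun setT (X i k).
Hypothesis indX : indep_vectors P X.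
Hypothesis rankX : forall i k t, \int[P]_w Num.sg (t - X i k w) = centered_rank t.

Lemma bounded_entry k l : bounded_measurable (fun w => (rho_tilde X w - Wmat X w) k l).
Proof.
under eq_fun do rewrite entry_decomposition.
have bS k' l' : bounded_measurable (fun w => \sum_a rank_cross X k' l' a w).
  by apply: bounded_measurable_sum => a _; exact: bounded_rank_cross.
have bD : bounded_measurable (fun w => \sum_t double_deviation X k l t w).
  by apply: bounded_measurable_sum => t _; exact: bounded_double_deviation.
apply: bounded_measurableM; first exact: bounded_measurable_cst.
by apply: bounded_measurableD => //; apply: bounded_measurableD;
  apply: bounded_measurableM => //; exact: bounded_measurable_cst.
Qed.

Lemma entry_second_moment k l (c0 : R) : 0 <= c0 ->
  (forall i a, `|\int[P]_w ((Num.sg (X i k w - a) - centered_rank (X i k w)) *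
     centered_rank (X i l w))| <= c0) ->
  (forall i a, `|\int[P]_w ((Num.sg (X i l w - a) - centered_rank (X i l w)) *
     centered_rank (X i k w))| <= c0) ->
  \int[P]_w (((rho_tilde X w - Wmat X w) k l) ^+ 2) <=
  moment_constant R * (c0 / n%:R + n%:R^-2).
Proof.
move=> c00 covkl covlk.
have nR : 3 <= n%:R :> R by rewrite (ler_nat R 3 n).
pose c' := c; pose al := c * (n%:R - 2).
have c_ge0 : 0 <= c' by have [/andP[]] := normalization_le nR.
have c_le : c' <= 14 / n%:R ^+ 3 by have [/andP[]] := normalization_le nR.
have al_ge0 : 0 <= al by have [_ /andP[]] := normalization_le nR.
have al_le : al <= 5 / n%:R ^+ 2 by have [_ /andP[]] := normalization_le nR.
pose S1 w := \sum_a rank_cross X k l a w.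
pose S2 w := \sum_a rank_cross X l k a w.
pose S3 w := \sum_t double_deviation X k l t w.
have h1 : \int[P]_w (S1 w ^+ 2) <= 8 * n%:R ^+ 2 + 2 * c0 * n%:R ^+ 3.
  exact: rank_cross_second_moment covkl.
have h2 : \int[P]_w (S2 w ^+ 2) <= 8 * n%:R ^+ 2 + 2 * c0 * n%:R ^+ 3.
  exact: rank_cross_second_moment covlk.
have h3 : \int[P]_w (S3 w ^+ 2) <= 144 * n%:R ^+ 4.
  exact: double_deviation_second_moment.
have b1 : bounded_measurable (fun w => S1 w ^+ 2).
  by apply: bounded_measurableM; apply: bounded_measurable_sum => a _; exact: bounded_rank_cross.
have b2 : bounded_measurable (fun w => S2 w ^+ 2).
  by apply: bounded_measurableM; apply: bounded_measurable_sum => a _; exact: bounded_rank_cross.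
have b3 : bounded_measurable (fun w => S3 w ^+ 2).
  by apply: bounded_measurableM; apply: bounded_measurable_sum => a _; exact:
      bounded_double_deviation.
have bE := bounded_entry k l.
have dec w : (rho_tilde X w - Wmat X w) k l = al * S1 w + al * S2 w + c' * S3 w.
  rewrite entry_decomposition -/(S1 w) -/(S2 w) -/(S3 w) /al /c'.
  by move: (S1 w) (S2 w) (S3 w) c (n%:R - 2 : R) => s1 s2 s3 c'' N'; ring.
clearbody al c'.
clearbody S1 S2 S3.
have i1 : 0 <= \int[P]_w (S1 w ^+ 2) by apply: Rintegral_ge0 => w _; exact: sqr_ge0.
have i2 : 0 <= \int[P]_w (S2 w ^+ 2) by apply: Rintegral_ge0 => w _; exact: sqr_ge0.
have i3 : 0 <= \int[P]_w (S3 w ^+ 2) by apply: Rintegral_ge0 => w _; exact: sqr_ge0.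
apply: le_trans (second_moment_numeric nR c00 c_ge0 c_le al_ge0 al_le i1 h1 i2 h2 i3 h3).
have bZ (r : R) (f : T -> R) : bounded_measurable f -> bounded_measurable (fun w => r * f w).
  by move=> bf; apply: bounded_measurableM => //; exact: bounded_measurable_cst.
have Z (r : R) (f : T -> R) (bf : bounded_measurable f) :=
  RintegralZl r measurableT (bounded_measurable_integrable P bf).
have Z1 : 3 * al ^+ 2 * \int[P]_w (S1 w ^+ 2) = \int[P]_w (3 * al ^+ 2 * S1 w ^+ 2) := esym (Z
    _ _ b1).
have Z2 : 3 * al ^+ 2 * \int[P]_w (S2 w ^+ 2) = \int[P]_w (3 * al ^+ 2 * S2 w ^+ 2) := esym (Z
    _ _ b2).
have Z3 : 3 * c' ^+ 2 * \int[P]_w (S3 w ^+ 2) = \int[P]_w (3 * c' ^+ 2 * S3 w ^+ 2) := esym (Z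
    _ _ b3).
rewrite Z1 Z2 Z3.
rewrite -RintegralD //; try (apply: bounded_measurable_integrable; exact: bZ).
rewrite -RintegralD //; last 2 first.
- by apply: bounded_measurable_integrable; apply: bounded_measurableD; exact: bZ.
- by apply: bounded_measurable_integrable; exact: bZ.
apply: le_Rintegral => //.
- by apply: bounded_measurable_integrable; apply: bounded_measurableM.
- apply: bounded_measurable_integrable; apply: bounded_measurableD; last exact: bZ.
  by apply: bounded_measurableD; exact: bZ.
move=> w _; rewrite dec; exact: sqr_sum3_le.
Qed.

End Entry.

(** [C] depends on [e] alone, uniformly in the space, the dimension and the vector, hence serves for
    all [n] at once. The tail costs [4 * (e / 8)]; the linear term is absorbed by
    [4 m x <= e / 2 + 8 m^2 x^2 / e], whose squares sum to the trace. *)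
Lemma covariance_bound (R : realType) (e : R) : 0 < e ->
  exists2 C : R, 0 <= C & forall (d : measure_display) (T : measurableType d)
    (P : probability T R) (p : nat) (S : 'M[R]_p) (Y : 'I_p -> T -> R),
    (forall k, measurable_fun setT (Y k)) -> gaussian_vector P S Y -> S^T = S ->
    (forall k, S k k = 1) -> forall k l a,
    `|\int[P]_w ((Num.sg (Y k w - a) - centered_rank (Y k w)) * centered_rank (Y l w))| <=
    e + C * S k l ^+ 2.
Proof.
move=> e0; have e8 : 0 < e / 8 by rewrite divr_gt0.
have [N N0 hN] := normal_tail e8.
pose m := normal_peak 1 * N.
exists (8 * m ^+ 2 / e) => [|d T P p S Y mY gY symS diagS k l a].
  by apply: divr_ge0; [apply: mulr_ge0; [exact: ler0n|exact: sqr_ge0]|exact: ltW].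
apply: (le_trans (sgr_rank_covariance mY gY symS diagS k l a N0)).
have -> : e + 8 * m ^+ 2 / e * S k l ^+ 2 =
   (e / 2 + 8 * m ^+ 2 / e * `|S k l| ^+ 2) + 4 * (e / 8).
  by rewrite real_normK ?num_real //; field; rewrite gt_eqF.
apply: lerD; last by rewrite ler_pM2l.
have -> : normal_peak 1 * `|S k l| * N = m * `|S k l| by rewrite /m mulrAC.
move: m (`|S k l|) => m x.
rewrite -subr_ge0 (_ : _ - _ = (e - 4 * m * x) ^+ 2 / (2 * e)); last by field; rewrite gt_eqF.
by rewrite divr_ge0 ?sqr_ge0 // mulr_ge0 // ltW.
Qed.

(** * Frobenius norm and Levy distance at fixed size *)

Section FixedSize.
Context (R : realType) (d : measure_display) (T : measurableType d) (P : probability T R).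
Context (n p : nat) (X : 'I_n -> 'I_p -> T -> R) (S : 'M[R]_p).
Hypothesis n3 : (3 <= n)%N.
Hypothesis mX : forall i k, measurable_fun setT (X i k).
Hypothesis indX : indep_vectors P X.
Hypothesis rankX : forall i k t, \int[P]_w Num.sg (t - X i k w) = centered_rank t.
Hypothesis symS : S^T = S.

Local Notation D w := (rho_tilde X w - Wmat X w).

Lemma bounded_frobsq : bounded_measurable (fun w => frobsq (D w)).
Proof.
apply: bounded_measurable_sum => k _; apply: bounded_measurable_sum => l _.
by apply: bounded_measurableM; exact: bounded_entry.
Qed.

Lemma Rintegral_frobsq_le (e C : R) : 0 <= e -> 0 <= C ->
  (forall i k l a, `|\int[P]_w ((Num.sg (X i k w - a) - centered_rank (X i k w)) *
    centered_rank (X i l w))| <= e + C * S k l ^+ 2) ->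
  \int[P]_w frobsq (D w) <= moment_constant R *
    ((e * p%:R ^+ 2 + C * \tr (S *m S)) / n%:R + p%:R ^+ 2 * n%:R^-2).
Proof.
move=> e0 C0 cov; set K := moment_constant R.
have bE k l : bounded_measurable (fun w => D w k l ^+ 2).
  by apply: bounded_measurableM; exact: bounded_entry.
rewrite Rintegral_sum => [|k _]; last exact: bounded_measurable_sum.
apply: (@le_trans _ _ (\sum_(k < p) \sum_(l < p) K * ((e + C * S k l ^+ 2) / n%:R + n%:R^-2))).
  apply: ler_sum => k _; rewrite Rintegral_sum => [|l _]; last exact: bE.
  apply: ler_sum => l _; apply: entry_second_moment => //.
  - by rewrite addr_ge0 // mulr_ge0 // sqr_ge0.
  - have -> : S k l = S l k by rewrite -[in LHS]symS mxE.
    by move=> i a; exact: cov.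
have -> : \tr (S *m S) = \sum_(k < p) \sum_(l < p) S k l ^+ 2.
  apply: eq_bigr => k _; rewrite mxE; apply: eq_bigr => l _.
  by rewrite expr2 -[in X in _ * X]symS mxE.
have pp (r : R) : \sum_(k < p) \sum_(l < p) r = p%:R ^+ 2 * r.
  by rewrite !sumr_const card_ord expr2 -mulrA !mulr_natl.

rewrite le_eqVlt; apply/orP; left; apply/eqP.
transitivity (K * \sum_(k < p) \sum_(l < p) ((e / n%:R + n%:R^-2) + C / n%:R * S k l ^+ 2)).
  rewrite mulr_sumr; apply: eq_bigr => k _; rewrite mulr_sumr; apply: eq_bigr => l _.
  by congr (_ * _); ring.
congr (_ * _).
under eq_bigr do rewrite big_split /= -mulr_sumr.
rewrite big_split /= -mulr_sumr pp.
by move: (\sum_(_ < _) _) => s; ring.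
Qed.

Lemma rho_tilde_sym w : (rho_tilde X w)^T = rho_tilde X w.
Proof.
apply/matrixP => k l; rewrite mxE !rho_tildeE; congr (_ * _).
rewrite sum_distinct_swap; apply: eq_bigr => i _; apply: eq_bigr => j _.
by apply: eq_bigr => m _; rewrite mulrC.
Qed.

Lemma Wmat_sym w : (Wmat X w)^T = Wmat X w.
Proof.
apply/matrixP => k l; rewrite mxE !WmatE; congr (_ * _).
by apply: eq_bigr => i _; rewrite mulrC.
Qed.

Lemma measurable_Wmat k l : measurable_fun setT (fun w => Wmat X w k l).
Proof.
under eq_fun do rewrite WmatE.
apply: measurable_funM => //; apply: measurable_sum => i.
by apply: measurable_funM; apply: (measurableT_comp (@measurable_centered_rank R)).
Qed.

Lemma measurable_rho_tilde k l : measurable_fun setT (fun w => rho_tilde X w k l).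
Proof.
have -> : (fun w => rho_tilde X w k l) = (fun w => D w k l + Wmat X w k l).
  by apply/funext => w; rewrite !mxE subrK.
apply: measurable_funD; last exact: measurable_Wmat.
exact: (bounded_entry n3 mX k l).1.
Qed.

(** On the event, the contrapositive of [levy_near_esd] makes the squared norm at least
    [p * eps ^+ 3]. *)
Lemma levy_probability_le (eps : R) : (0 < p)%N -> 0 < eps ->
  p%:R * eps ^+ 3 * fine (P [set w | eps < levy (esd (rho_tilde X w)) (esd (Wmat X w))]) <=
  \int[P]_w frobsq (D w).
Proof.
move=> p0 eps0; set E := [set w | _].
have mE : measurable E.
  apply: measurable_levy_gt => //; [exact: rho_tilde_sym|exact: Wmat_sym| |].
  - exact: measurable_rho_tilde.
  - exact: measurable_Wmat.
rewrite -(Rintegral_indic_probability P mE) -RintegralZl //; last first.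
  by apply: bounded_measurable_integrable; exact: bounded_measurable_indic.
apply: le_Rintegral => //.
- apply: bounded_measurable_integrable; apply: bounded_measurableM.
    exact: bounded_measurable_cst.
  exact: bounded_measurable_indic.
- by apply: bounded_measurable_integrable; exact: bounded_frobsq.
move=> w _; rewrite indicE; have [wE|wE] := boolP (w \in E); last first.
  by rewrite mulr0 frobsq_ge0.
rewrite mulr1 leNgt; apply/negP => h.
move: wE; rewrite inE /E /= ltNge => /negP; apply.
apply: levy_le; apply: levy_near_esd => //; [exact: rho_tilde_sym|exact: Wmat_sym|].
exact: ltW.
Qed.

End FixedSize.

(** * Passage to the limit *)

Theorem theorem1 (R : realType) (d : measure_display) (T : measurableType d)
  (P : probability T R) (p : nat -> nat)
  (Sigma : forall n : nat, 'M[R]_(p n))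
  (X : forall n : nat, 'I_n -> 'I_(p n) -> T -> R) (y : R) :
  (forall n (i : 'I_n) (k : 'I_(p n)), measurable_fun setT (X n i k)) ->
  (forall n, indep_vectors P (X n)) ->
  (forall n (i : 'I_n), gaussian_vector P (Sigma n) (X n i)) ->
  (forall n, (Sigma n)^T = Sigma n) ->
  (forall n (k : 'I_(p n)), Sigma n k k = 1) ->
  0 < y ->
  (fun n : nat => ((p n)%:R / n%:R : R)) @ \oo --> y ->
  (fun n : nat => \tr (Sigma n *m Sigma n) / ((p n)%:R ^+ 2) : R) @ \oo --> (0:R) ->
  forall eps : R, 0 < eps ->
    (fun n : nat => P [set w | eps < levy (esd (rho_tilde (X n) w))
                                     (esd (Wmat (X n) w))]) @ \oo --> 0%E.
Proof.
move=> mX indX gX symS diagS y0 pn tr0 eps eps0.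
pose E n := [set w | eps < levy (esd (rho_tilde (X n) w)) (esd (Wmat (X n) w))].
pose K := moment_constant R / eps ^+ 3.
have K0 : 0 <= K.
  by rewrite divr_ge0 ?exprn_ge0 ?(ltW eps0) ?moment_constant_ge0.
pose r n : R := (p n)%:R / n%:R.
pose tau n : R := \tr (Sigma n *m Sigma n) / (p n)%:R ^+ 2.
(* The Frobenius bound divided by [p * eps ^+ 3], rewritten in the ratios [r n], which tends to [y],
   and [tau n], which tends to 0. *)
have bound e : 0 < e -> exists2 C : R, 0 <= C & forall n, (3 <= n)%N -> (0 < p n)%N ->
    (P (E n) <= (K * (e * r n + C * (tau n * r n) + r n / n%:R))%:E)%E.
  move=> e0; have [C C0 cov] := covariance_bound e0; exists C => // n n3 p0.
  have rankX i k t : \int[P]_w Num.sg (t - X n i k w) = centered_rank t.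
    exact: (Rintegral_sgr_gaussian (mX n i) (gX n i) (symS n) (diagS n)).
  have mE : measurable (E n).
    apply: measurable_levy_gt => //; [exact: rho_tilde_sym|exact: Wmat_sym| |].
    - exact: measurable_rho_tilde.
    - exact: measurable_Wmat.
  rewrite -[leLHS]fineK ?fin_num_measure // lee_fin.
  have h1 := levy_probability_le P n3 (mX n) p0 eps0.
  have h2 := Rintegral_frobsq_le n3 (mX n) (indX n) rankX (symS n) (ltW e0) C0
    (fun i => cov _ _ _ _ _ _ (mX n i) (gX n i) (symS n) (diagS n)).
  have pR : 0 < (p n)%:R :> R by rewrite ltr0n.
  have nR : 0 < n%:R :> R by rewrite ltr0n; case: (n) n3.
  have pe : 0 < (p n)%:R * eps ^+ 3 by rewrite mulr_gt0 // exprn_gt0.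
  rewrite -(ler_pM2l pe); apply: (le_trans h1); apply: (le_trans h2).
  rewrite le_eqVlt; apply/orP; left; apply/eqP; rewrite /K /r /tau.
  move: (\tr _) (moment_constant R) => t M.
  by field; rewrite !gt_eqF.
apply/fine_cvgP; split.
  have [C C0 hC] := bound 1 ltr01; near=> n.
  rewrite ge0_fin_numE ?measure_ge0 //.
  apply: (le_lt_trans (hC n _ _)); last exact: ltry.
  - by near: n; exact: nbhs_infty_ge.
  (* [r n] would be 0 for [p n = 0], so the positive limit [y] makes the dimension positive from
     some point on. *)
  - have : 0 < r n by near: n; exact: (cvgr_gt y pn _ y0).
    by rewrite /r; case: (p n) => //; rewrite mul0r ltxx.
apply/cvgr0Pnorm_le => dl dl0.
(* Each of the three terms will be at most [q], and [K * (3 * q) = dl * (K / (K + 1))] is at most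
   [dl]; [K + 1] keeps the denominator positive. *)
pose q := dl / (3 * (K + 1)).
have K1 : 0 < K + 1 by rewrite ltr_wpDl.
have q0 : 0 < q by rewrite divr_gt0 // mulr_gt0.
have y1 : 0 < y + 1 by rewrite addr_gt0.
have qy0 : 0 < q / (y + 1) by rewrite divr_gt0.
(* Order of the choices: [e = q / (y + 1)], because eventually [r n <= y + 1]; then [C], which
   depends on [e]; then the threshold [q / (y + 1) / (C + 1)] for [tau n]. *)
have [C C0 hC] := bound _ qy0.
have C1 : 0 < C + 1 by rewrite ltr_wpDl.
have eta0 : 0 < q / (y + 1) / (C + 1) by rewrite divr_gt0.
near=> n.
have n3 : (3 <= n)%N by near: n; exact: nbhs_infty_ge.
have r0 : 0 < r n by near: n; exact: (cvgr_gt y pn _ y0).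
have p0 : (0 < p n)%N.
  by move: r0; rewrite /r; case: (p n) => //; rewrite mul0r ltxx.
have r1 : r n <= y + 1.
  by near: n; apply: (cvgr_le y pn); rewrite ltrDl.
have tau1 : tau n <= q / (y + 1) / (C + 1).
  by near: n; exact: (cvgr_le 0 tr0 _ eta0).
have n1 : n%:R^-1 <= q / (y + 1).
  near: n; have [N _ hN] := near_infty_natSinv_lt (PosNum qy0).
  exists N.+1 => // -[|m] //= Nm; exact/ltW/hN.
have h := hC n n3 p0.
have fE : P (E n) \is a fin_num.
  by rewrite ge0_fin_numE ?measure_ge0 // (le_lt_trans h) // ltry.
have {h}h : fine (P (E n)) <= K * (q / (y + 1) * r n + C * (tau n * r n) + r n / n%:R).
  by rewrite -lee_fin fineK.
rewrite /= ger0_norm ?fine_ge0 ?measure_ge0 //; apply: (le_trans h).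
have t1 : q / (y + 1) * r n <= q.
  by rewrite -[leRHS](divfK (negbT (gt_eqF y1))) ler_pM2l.
have t3 : r n / n%:R <= q.
  by rewrite mulrC (le_trans _ t1) // ler_pM2r.
have t2 : C * (tau n * r n) <= q.
  apply: (@le_trans _ _ (C * (q / (y + 1) / (C + 1) * r n))).
    by rewrite ler_wpM2l // ler_pM2r.
  rewrite [_ / (C + 1) * _]mulrAC mulrCA -[leRHS]mulr1; apply: ler_pM => //.
  - by rewrite mulr_ge0 // ltW.
  - by rewrite divr_ge0 // ltW.
  - by rewrite ler_pdivrMr // mul1r lerDl.
apply: (@le_trans _ _ (K * (q + q + q))); first by rewrite ler_wpM2l // !lerD.
have -> : K * (q + q + q) = dl * (K / (K + 1)).
  have thirds (k a : R) : 0 < k + 1 ->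
      k * (a / (3 * (k + 1)) + a / (3 * (k + 1)) + a / (3 * (k + 1))) = a * (k / (k + 1)).
    by move=> k1; field; rewrite gt_eqF.
  exact: thirds.
rewrite ler_piMr ?(ltW dl0) // ler_pdivrMr // mul1r lerDl //.
Unshelve. all: by end_near.
Qed.
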